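(* Let $K$ be an infinite field and let $n>d>0$ be integers. Let $U\subset R_{[n-d-1]}$ be a shifted order ideal of monomials of degree at most $\lfloor\frac d2\rfloor$, and let $S_d(U)$ be the corresponding squeezed $(d-1)$-sphere on $[n]$. Then $$U(S_d(U))=U,$$ where $U(S_d(U))=\{u\in R_{[n-d-1]} : u\notin \mathrm{gin}(I_{S_d(U)}) \text{ is a monomial}\}$.
   Context: $K$ is an infinite field, $R_{[n]}=K[x_1,\dots,x_n]$ with each $\deg x_i=1$ ($R_{[0]}=K$), and $[n]=\{1,\dots,n\}$. For a graded ideal $I\subset R_{[n]}$, $\mathrm{gin}(I)$ is the generic initial ideal of $I$ with respect to the degree reverse lexicographic order induced by $x_1>\cdots>x_n$. The Stanley--Reisner ideal $I_\Gamma\subset R_{[n]}$ of a simplicial complex $\Gamma$ on $[n]$ is generated by all squarefree monomials $x_{i_1}\cdots x_{i_k}$ with $\{i_1,\dots,i_k\}\notin\Gamma$. For a $(d-1)$-dimensional simplicial complex $\Gamma$ on $[n]$, $U(\Gamma)$ is the set of monomials $u\in R_{[n-d-1]}$ with $u\notin\mathrm{gin}(I_\Gamma)$. For monomials $u=x_{i_1}\cdots x_{i_k}$, $v=x_{j_1}\cdots x_{j_k}$ of the same degree with $i_1\le\cdots\le i_k$, $j_1\le\cdots\le j_k$, write $u\preceq v$ if $i_p\le j_p$ for all $p$. A set $U$ of monomials of $R_{[m]}$ is a shifted order ideal of monomials if (i) $\{1,x_1,\dots,x_m\}\subset U$; (ii) $u\in U$ and $v$ divides $u$ imply $v\in U$;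 (iii) $u\in U$, $v\in R_{[m]}$ a monomial and $u\preceq v$ imply $v\in U$. It is ''of degree at most $k$'' if all its elements have degree at most $k$. Squeezed balls and spheres: with $m=n-d-1$ and $U\subset R_{[m]}$ a shifted order ideal of monomials of degree at most $\lfloor\frac{d+1}{2}\rfloor$, for $u=x_{i_1}\cdots x_{i_k}\in U$ with $i_1\le\cdots\le i_k$ put $$F_d(u)=\{i_1,i_1+1\}\cup\{i_2+2,i_2+3\}\cup\cdots\cup\{i_k+2(k-1),i_k+2k-1\}\cup\{n+2k-d,n+2k-d+1,\dots,n\},$$ a $(d+1)$-subset of $[n]$ (with $F_d(1)=\{n-d,\dots,n\}$). The squeezed $d$-ball $B_d(U)$ is the simplicial complex generated by $\{F_d(u):u\in U\}$; it is a shellable $d$-ball, and the squeezed $(d-1)$-sphere $S_d(U)$ is its boundary, i.e. the complex generated by the $d$-subsets of $[n]$ contained in exactly one facet of $B_d(U)$. *)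

(* Defs.v *)
From mathcomp Require Import all_boot all_algebra.
From mathcomp Require Export mpoly.

Set Implicit Arguments.
Unset Strict Implicit.
Unset Printing Implicit Defensive.

Import GRing.Theory.
Local Open Scope ring_scope.

(* Conventions: the variable x_(i+1) of K[x_1, ..., x_n] is 'X_i with i : 'I_n,
   and the vertex i+1 of [n] is i : 'I_n.  A monomial is its exponent vector.
   Sets of polynomials, of monomials and of faces are Prop-valued predicates. *)

Section Ideals.
Variables (K : fieldType) (n : nat).
Implicit Types (G I J : {mpoly K[n]} -> Prop) (p q : {mpoly K[n]}).

Definition ideal_span G p : Prop :=
  exists2 s : seq ({mpoly K[n]} * {mpoly K[n]}),
    (forall c, c \in s -> G c.2) & p = \sum_(c <- s) c.1 * c.2.

(* Degree reverse lexicographic order with x_1 > ... > x_n.  The library's own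
   order on 'X_{1..n} (and hence [mlead]) compares the first differing exponent,
   so it is degree lexicographic, although its documentation says degrevlex. *)
Definition drl_lt (u v : 'X_{1..n}) : bool :=
  (mdeg u < mdeg v)%N ||
  ((mdeg u == mdeg v) &&
   [exists i : 'I_n, (v i < u i)%N &&
      [forall j : 'I_n, (i < j)%N ==> (u j == v j)]]).

Definition is_initial p (u : 'X_{1..n}) : Prop :=
  u \in msupp p /\ forall v, v \in msupp p -> v != u -> drl_lt v u.

Definition initial_ideal I : {mpoly K[n]} -> Prop :=
  ideal_span (fun q => exists p u, [/\ I p, is_initial p u & q = 'X_[u]]).

Definition lin_change (g : 'M[K]_n) p : {mpoly K[n]} :=
  p \mPo [tuple \sum_(i < n) g i j *: 'X_i | j < n].

Definition lin_change_ideal (g : 'M[K]_n) I : {mpoly K[n]} -> Prop :=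
  fun q => exists2 p, I p & q = lin_change g p.

Definition GL_zariski_open (O : 'M[K]_n -> Prop) : Prop :=
  exists S : {mpoly K[n * n]} -> Prop, forall g : 'M[K]_n,
    O g <-> g \in unitmx /\ exists2 f, S f & f.@[mxvec g 0] != 0.

Definition is_gin I J : Prop :=
  exists O : 'M[K]_n -> Prop,
    [/\ GL_zariski_open O, exists g, O g &
        forall g, O g -> forall q, initial_ideal (lin_change_ideal g I) q <-> J q].

(* Over an infinite field, an ideal [J] with [is_gin I J] exists and is unique
   when [I] is a graded ideal, and then [gin I] is that [J]. *)
Definition gin I : {mpoly K[n]} -> Prop :=
  fun q => exists2 J, is_gin I J & J q.

End Ideals.

Section Complexes.
Variable n : nat.
Implicit Types (C D : {set 'I_n} -> Prop).

Definition generated_complex D : {set 'I_n} -> Prop :=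
  fun F => exists2 H, D H & F \subset H.

Definition facet C (F : {set 'I_n}) : Prop :=
  C F /\ forall H : {set 'I_n}, C H -> F \subset H -> H = F.

Definition stanley_reisner (K : fieldType) C : {mpoly K[n]} -> Prop :=
  ideal_span (fun q =>
    exists2 F : {set 'I_n}, ~ C F & q = \prod_(i in F) 'X_i).

End Complexes.

Arguments stanley_reisner {n} K C _.

Section Squeezed.
Variable n : nat.
Implicit Types (u v : 'X_{1..n}) (U : 'X_{1..n} -> Prop) (m d k : nat).

(* u is a monomial of the subring K[x_1, ..., x_m] of K[x_1, ..., x_n] *)
Definition in_first m u : Prop := forall i : 'I_n, (m <= i)%N -> u i = 0%N.

(* The sequence i_1 <= ... <= i_k, numbered from 1, with
   u = x_(i_1) ... x_(i_k). *)
Definition indices u : seq nat :=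
  flatten [seq nseq (u i) i.+1 | i : 'I_n].

(* [all2] requires both sequences to have the same length. *)
Definition mon_preceq u v : bool := all2 leq (indices u) (indices v).

Definition shifted_order_ideal m U : Prop :=
  [/\ forall u, U u -> in_first m u,
      U 0%MM /\ (forall i : 'I_n, (i < m)%N -> U U_(i)%MM),
      forall u v, U u -> (v <= u)%MM -> U v &
      forall u v, U u -> in_first m v -> mon_preceq u v -> U v].

Definition degree_at_most k U : Prop := forall u, U u -> (mdeg u <= k)%N.

(* The element j of 'I_n stands for the vertex j.+1, and p counts from 0. *)
Definition Fd d u : {set 'I_n} :=
  [set j : 'I_n |
     [exists p : 'I_(mdeg u),
        (j.+1 == nth 0%N (indices u) p + 2 * p)%N ||
        (j.+1 == nth 0%N (indices u) p + 2 * p + 1)%N]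
     || (n + 2 * mdeg u - d <= j.+1)%N].

Definition squeezed_ball d U : {set 'I_n} -> Prop :=
  generated_complex (fun F => exists2 u, U u & F = Fd d u).

Definition squeezed_sphere d U : {set 'I_n} -> Prop :=
  generated_complex (fun G => #|G| = d /\
    exists! F : {set 'I_n}, facet (squeezed_ball d U) F /\ G \subset F).

(* The set U(C), for a (d-1)-dimensional complex C on [n] *)
Definition Uset (K : fieldType) d (C : {set 'I_n} -> Prop) : 'X_{1..n} -> Prop :=
  fun u => in_first (n - d - 1) u /\ ~ gin (stanley_reisner K C) 'X_[u].

End Squeezed.

(* Main.v *)
Require Import Defs.
From mathcomp Require Import all_boot all_algebra zify.
From Stdlib Require Import Classical.

(** Put m = n - d - 1, let B be the squeezed ball of U and S its boundary, and
    for a monomial u = x_(i_1) ... x_(i_k) with sorted indices let its spread be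
    the vertex set i_1, i_2 + 2, ..., i_k + 2(k - 1).

    Combinatorics.  If the spread of v lies in the facet F_d(w), then each of its
    elements sits in a different one of the pairs of F_d(w), because consecutive
    elements differ by at least 2 and the final interval of F_d(w) is too far to
    the right; so v is obtained from a divisor of w by increasing indices
    ([spread_sub_refines]).  Since U is shifted, the spread of a monomial outside
    U is not a face of B ([spread_nonface]).  The same fact shows that S contains
    every face of B with at most d/2 vertices ([ball_sub_sphere]).

    Monomials outside U.  Let l_j be the image of x_j under a generic change of
    coordinates g.  The ideal g(I_B) contains l_(j_1) l_(j_2 + 2) l_(j_3 + 4) ...
    whenever x_(j_1) x_(j_2) ... is not in U.  Fix u of degree k and last index
    a, and let u' be u without its last variable.  Modulo the variables after
    x_a, the span of the products attached to the monomials below u contains x_a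
    times the span attached to the monomials below u' ([exchange_space]), so by
    induction on the degree it contains a form with initial monomial u
    ([initial_of_spreads]).  Hence all monomials of K[x_1, ..., x_m] outside U
    are initial monomials of g(I_B), in every characteristic
    ([nonmember_initial]).

    Monomials in U.  For each u in U there is a zero of g(I_B) with
    x_(m+1) = 1 and x_j = 0 for j > m + 1 that g maps to a point whose nonzero
    coordinates are exactly the vertices of F_d(u) ([facet_point]).  If some u0
    in U were also an initial monomial, then on these |U| points every
    polynomial would agree with a combination of the |U| - 1 monomials of U other
    than u0; but the functions on the points have dimension |U|
    ([member_not_initial]).

    From B to S.  As I_B is contained in I_S, monomials outside U are initial
    monomials of g(I_S).  As I_B and I_S agree in degrees at most d/2, which
    bounds the degrees in U, no monomial of U is one.

    It remains to see that the generic initial ideal exists ([gin_exists]).  In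
    bounded degree the initial monomials of g(I) are read off from the ranks of
    submatrices of a matrix whose entries are polynomials in the entries of g,
    and these ranks take their maximal value for generic g.  By Dickson's lemma
    finitely many degrees generate the resulting monomial ideal, and comparison
    of dimensions handles the remaining degrees. *)

Set Implicit Arguments.
Unset Strict Implicit.
Unset Printing Implicit Defensive.
Import GRing.Theory.

(** * Monomials as sorted lists of vertices *)

Section IndexLists.
Variable n : nat.
Implicit Types (u v w : 'X_{1..n}) (s t : seq nat) (m k : nat).

(** Lists are numbered as in the definition of the indices of a monomial: the
    entry c stands for the variable x_c, that is, for the ordinal c - 1. *)
Definition mon s : 'X_{1..n} := [multinom count_mem i.+1 s | i < n].

Definition on_vertices s := all (fun c => 0 < c <= n) s.

Lemma mon_cat s t : mon (s ++ t) = (mon s + mon t)%MM.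
Proof. by apply/mnmP=> i; rewrite mnmDE !mnmE count_cat. Qed.

Lemma mon_cons c s : mon (c :: s) = (mon [:: c] + mon s)%MM.
Proof. by rewrite -mon_cat. Qed.

Lemma mon_rcons s c : mon (rcons s c) = (mon s + mon [:: c])%MM.
Proof. by rewrite -cats1 mon_cat. Qed.

Lemma mon1 (i : 'I_n) : mon [:: i.+1] = U_(i)%MM.
Proof. by apply/mnmP=> j; rewrite mnmE mnm1E /= addn0 eqSS. Qed.

Lemma mon_nil : mon [::] = 0%MM.
Proof. by apply/mnmP=> j; rewrite !mnmE. Qed.

Lemma perm_mon s t : perm_eq s t -> mon s = mon t.
Proof. by move/permP=> st; apply/mnmP=> i; rewrite !mnmE st. Qed.

Lemma vertex_ord c : 0 < c <= n -> exists i : 'I_n, c = i.+1.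
Proof. by case: c => // c lt_cn; exists (Ordinal lt_cn). Qed.

Lemma mdeg_mon s : on_vertices s -> mdeg (mon s) = size s.
Proof.
elim: s => [|c s IHs] /=; first by rewrite mon_nil mdeg0.
case/andP=> /vertex_ord [i ->] /IHs.
by rewrite mon_cons mdegD mon1 mdeg1 => ->.
Qed.

Lemma indices_sorted u : sorted leq (indices u).
Proof.
rewrite sorted_pairwise; last exact: leq_trans.
rewrite /indices.
have: pairwise (fun i j : 'I_n => i < j) (enum 'I_n).
  rewrite -sorted_pairwise; last by move=> ? ? ?; apply: ltn_trans.
  by have:= iota_ltn_sorted 0 n; rewrite -val_enum_ord sorted_map.
rewrite /image_mem; elim: (enum _) => //= i r IHr /andP[lt_ir /IHr {}IHr].
rewrite pairwise_cat IHr andbT; apply/andP; split.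
  apply/allrelP=> a b /nseqP[-> _] /flatten_mapP[j /(allP lt_ir) lt_ij].
  by case/nseqP=> -> _; rewrite ltnS ltnW.
by elim: (u i) => //= k ->; rewrite andbT; apply/allP=> a /nseqP[->].
Qed.

Lemma count_indices u (i : 'I_n) : count_mem i.+1 (indices u) = u i.
Proof.
rewrite /indices count_flatten -map_comp sumnE big_map /= big_enum /=.
rewrite (bigD1 i) //= count_nseq /= eqxx mul1n big1 ?addn0 // => j ne_ji.
by rewrite count_nseq /= eqSS (inj_eq val_inj) (negPf ne_ji).
Qed.

Lemma indices_on_vertices u : on_vertices (indices u).
Proof.
by apply/allP=> c /flatten_mapP[i _ /nseqP[-> _]]; rewrite /= ltn_ord.
Qed.

Lemma indicesK u : mon (indices u) = u.
Proof. by apply/mnmP=> i; rewrite mnmE count_indices. Qed.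

Lemma size_indices u : size (indices u) = mdeg u.
Proof. by rewrite -mdeg_mon ?indices_on_vertices // indicesK. Qed.

Lemma mem_indices u (i : 'I_n) : (i.+1 \in indices u) = (0 < u i).
Proof. by rewrite -count_indices -has_count has_pred1. Qed.

Lemma monK s : sorted leq s -> on_vertices s -> indices (mon s) = s.
Proof.
move=> s_sorted s_vtx; apply: (@sorted_eq _ leq) => //.
- exact: leq_trans.
- exact: anti_leq.
- exact: indices_sorted.
apply/allP=> c; rewrite mem_cat => c_in; apply/eqP.
have /vertex_ord[i ->]: 0 < c <= n.
  by case/orP: c_in; [apply: (allP (indices_on_vertices _)) | apply: (allP s_vtx)].
by rewrite count_indices mnmE.
Qed.

Lemma in_firstP m u : in_first m u <-> {in indices u, forall c, c <= m}.
Proof.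
split=> [u_m c|u_m i le_mi].
  move=> c_in; have /vertex_ord[i def_c] := allP (indices_on_vertices u) _ c_in.
  move: c_in; rewrite def_c mem_indices [i.+1 <= m]leqNgt.
  by apply: contraL => /u_m ->.
apply/eqP; rewrite -leqn0 leqNgt; apply/negP.
by rewrite -mem_indices => /u_m; rewrite leqNgt ltnS le_mi.
Qed.

Lemma mon_take k u : (mon (take k (indices u)) <= u)%MM.
Proof.
apply/mnm_lepP=> i; rewrite mnmE -[X in _ <= X]count_indices.
by rewrite -[in X in _ <= X](cat_take_drop k (indices u)) count_cat leq_addr.
Qed.

Definition vertex_set s : {set 'I_n} := [set j : 'I_n | j.+1 \in s].

Lemma card_vertex_set_leq s : #|vertex_set s| <= size s.
Proof.
rewrite cardE -(size_map (fun j : 'I_n => j.+1)).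
apply: uniq_leq_size => [|c /mapP[j]]; last by rewrite mem_enum inE => ? ->.
by rewrite map_inj_uniq ?enum_uniq // => i j [/val_inj].
Qed.

Lemma card_vertex_set L : uniq L -> on_vertices L -> #|vertex_set L| = size L.
Proof.
move=> uniq_L L_n; rewrite cardE -(size_map (fun j : 'I_n => j.+1)).
apply/perm_size/uniq_perm => //.
  by rewrite map_inj_uniq ?enum_uniq // => i j [/val_inj].
move=> c; apply/mapP/idP => [[j]|L_c]; first by rewrite mem_enum inE => ? ->.
have /vertex_ord[j def_c] := allP L_n _ L_c.
by exists j; rewrite // mem_enum inE -def_c.
Qed.

End IndexLists.

(** * The facets of a squeezed ball *)

Section SpreadLists.
Implicit Types (s t : seq nat).

(** The vertices i_1, i_2 + 2, ..., i_k + 2(k - 1): the smaller elements of the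
    pairs of the facet attached to the monomial. *)
Definition spread s := mkseq (fun p => nth 0 s p + 2 * p) (size s).

Definition pairs t :=
  flatten [seq [:: nth 0 t p + 2 * p; nth 0 t p + 2 * p + 1] | p <- iota 0 (size t)].

(** The first indices of s form a divisor of its monomial that precedes the
    monomial of t. *)
Definition refines s t :=
  size t <= size s /\ forall p, p < size t -> nth 0 s p <= nth 0 t p.

Lemma mem_spread s c :
  reflect (exists2 p, p < size s & c = nth 0 s p + 2 * p) (c \in spread s).
Proof.
apply: (iffP mapP) => -[p]; first by rewrite mem_iota => ? ->; exists p.
by move=> lt_p ->; exists p; rewrite // mem_iota.
Qed.

Lemma size_spread s : size (spread s) = size s.
Proof. exact: size_mkseq. Qed.

Lemma mem_pairs t c :
  reflect (exists2 p, p < size t &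
             c = nth 0 t p + 2 * p \/ c = nth 0 t p + 2 * p + 1)
          (c \in pairs t).
Proof.
apply: (iffP flatten_mapP) => -[p].
  by rewrite mem_iota !inE => lt_p /orP[]/eqP->; exists p; auto.
move=> lt_p def_c; exists p; first by rewrite mem_iota.
by rewrite !inE; case: def_c => ->; rewrite eqxx ?orbT.
Qed.

Lemma size_pairs t : size (pairs t) = 2 * size t.
Proof.
rewrite size_flatten /shape -map_comp sumnE big_map /=.
by rewrite big_const_seq count_predT size_iota iter_addn_0.
Qed.

Lemma sorted_nth s p q : sorted leq s -> p <= q -> q < size s ->
  nth 0 s p <= nth 0 s q.
Proof.
move=> s_sorted le_pq lt_q.
by apply: (sorted_leq_nth leq_trans leqnn); rewrite ?inE //; lia.
Qed.

Lemma pairs_sorted t : sorted leq t -> sorted ltn (pairs t).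
Proof.
move=> t_sorted; rewrite sorted_pairwise; last exact: ltn_trans.
rewrite /pairs; set T := iota _ _.
have: pairwise ltn T by rewrite -sorted_pairwise ?iota_ltn_sorted //; exact: ltn_trans.
have: {in T, forall p, p < size t} by move=> p; rewrite mem_iota.
elim: T => //= p r IHr lt_r /andP[lt_p /IHr->].
  rewrite addn1 ltnSn /= andbT.
  have lt_c c :
      c \in flatten [seq [:: nth 0 t q + 2 * q; nth 0 t q + 2 * q + 1] | q <- r] ->
      nth 0 t p + 2 * p + 1 < c.
    case/flatten_mapP=> q r_q; rewrite !inE.
    have lt_pq := allP lt_p _ r_q.
    have := @sorted_nth t p q t_sorted (ltnW lt_pq) (lt_r _ _).
    by rewrite inE r_q orbT => /(_ isT) le_t /orP[]/eqP->; rewrite /= in lt_pq; lia.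
  by apply/andP; split; apply/allP=> c /lt_c /=; lia.
by move=> q r_q; apply: lt_r; rewrite inE r_q orbT.
Qed.

End SpreadLists.

Section Facets.
Variables n d : nat.
Hypothesis lt_dn : d < n.
Implicit Types (u v w : 'X_{1..n}) (s t : seq nat).
Local Notation m := (n - d - 1).

Definition tail_vertices k := iota (n + 2 * k - d) (d.+1 - 2 * k).

Lemma in_Fd u (j : 'I_n) :
  (j \in Fd d u) = (j.+1 \in pairs (indices u) ++ tail_vertices (mdeg u)).
Proof.
rewrite inE mem_cat mem_iota; congr (_ || _); last first.
  by have := ltn_ord j; lia.
apply/existsP/mem_pairs => [[p]|[p lt_p def_j]].
  by case/orP=> /eqP->; exists (val p); rewrite ?size_indices ?ltn_ord; auto.
rewrite size_indices in lt_p; exists (Ordinal lt_p) => /=.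
by case: def_j => ->; rewrite eqxx ?orbT.
Qed.

Lemma in_first_nth k u p : in_first k u -> p < size (indices u) ->
  nth 0 (indices u) p <= k.
Proof. by move=> /in_firstP u_k lt_p; apply/u_k/mem_nth. Qed.

Lemma nth_indices_gt0 u p : p < size (indices u) -> 0 < nth 0 (indices u) p.
Proof.
by move=> lt_p; case/andP: (allP (indices_on_vertices u) _ (mem_nth 0 lt_p)).
Qed.

Lemma facet_vertices_uniq u : in_first m u -> 2 * mdeg u <= d.+1 ->
  uniq (pairs (indices u) ++ tail_vertices (mdeg u)).
Proof.
move=> u_m deg_u; rewrite cat_uniq iota_uniq andbT.
rewrite (sorted_uniq ltn_trans ltnn) ?pairs_sorted ?indices_sorted //=.
apply/hasPn=> c; rewrite mem_iota => /andP[le_c _].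
apply/mem_pairs=> -[p lt_p def_c].
have := in_first_nth u_m lt_p; rewrite size_indices in lt_p.
by case: def_c; lia.
Qed.

Lemma pairs_on_vertices u : in_first m u -> 2 * mdeg u <= d.+1 ->
  on_vertices n (pairs (indices u) ++ tail_vertices (mdeg u)).
Proof.
move=> u_m deg_u; apply/allP=> c; rewrite mem_cat => /orP[].
  case/mem_pairs=> p lt_p def_c.
  have := in_first_nth u_m lt_p; have := nth_indices_gt0 lt_p.
  by rewrite size_indices in lt_p; case: def_c; lia.
by rewrite mem_iota; lia.
Qed.

Lemma card_Fd u : in_first m u -> 2 * mdeg u <= d.+1 -> #|Fd d u| = d.+1.
Proof.
move=> u_m deg_u.
transitivity (size (pairs (indices u) ++ tail_vertices (mdeg u))).
  rewrite -(@card_vertex_set n) ?facet_vertices_uniq ?pairs_on_vertices //.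
  by apply: eq_card => j; rewrite in_Fd inE.
by rewrite size_cat size_pairs size_iota size_indices; lia.
Qed.

(** Consecutive elements of a spread differ by at least 2, so no two of them
    lie in one pair, and the p-th of them lies in the p-th pair or a later one.
    None reaches the final interval: an index is at most m, so only the element
    of number mdeg u + 2 or more could, and there are not enough pairs for its
    predecessors. *)
Lemma spread_sub_refines u v : in_first m u -> in_first m v ->
  {subset spread (indices v) <= pairs (indices u) ++ tail_vertices (mdeg u)} ->
  refines (indices u) (indices v).
Proof.
move=> u_m v_m; rewrite -size_indices => sub.
have s_m p := @in_first_nth _ _ p v_m.
move: (indices_sorted v) (indices_sorted u) sub s_m {u_m v_m}.
move: (indices v) (indices u) => s t s_sorted t_sorted sub s_m.
have step p : p < size s -> exists2 q, p <= q < size t &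
    nth 0 s p + 2 * p = nth 0 t q + 2 * q \/
    nth 0 s p + 2 * p = nth 0 t q + 2 * q + 1.
  elim: p => [|p IHp] lt_p.
    have := sub (nth 0 s 0); rewrite mem_cat => /(_ _)/orP[].
    - by apply/mem_spread; exists 0; rewrite // addn0.
    - by case/mem_pairs=> q lt_q def_q; exists q; rewrite // muln0 addn0.
    by rewrite mem_iota; have := s_m _ lt_p; lia.
  have [q /andP[le_pq lt_q] def_q] := IHp (ltnW lt_p).
  have := sub (nth 0 s p.+1 + 2 * p.+1); rewrite mem_cat => /(_ _)/orP[].
  - by apply/mem_spread; exists p.+1.
  - case/mem_pairs=> r lt_r def_r; exists r => //.
    have := sorted_nth s_sorted (leqnSn p) lt_p.
    case: (leqP r q) => [le_rq|]; last by lia.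
    by have := sorted_nth t_sorted le_rq lt_q; lia.
  rewrite mem_iota; have := s_m _ lt_p; lia.
split.
  by case def_k: (size s) => [//|k]; have [|q] := step k; rewrite ?def_k; lia.
move=> p lt_p; have [q /andP[le_pq lt_q] def_q] := step p lt_p.
by have := sorted_nth t_sorted le_pq lt_q; lia.
Qed.
End Facets.

(** * Small faces of the ball and of its boundary *)

Lemma exists_max_nat (P : nat -> Prop) b :
  (exists k, P k) -> (forall k, P k -> k <= b) ->
  exists2 k, P k & forall l, P l -> l <= k.
Proof.
move=> [k0 Pk0] le_b.
elim: b => [|b IHb] in le_b *.
  exists k0 => // l /le_b; lia.
case: (classic (P b.+1)) => [Pb|nPb]; first by exists b.+1.
apply: IHb => k Pk; have := le_b k Pk.
by case: (k =P b.+1) => [k_b|]; [rewrite k_b in Pk | lia].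
Qed.

Section Spheres.
Variables n d : nat.
Hypothesis lt_dn : d < n.
Implicit Types (u v w : 'X_{1..n}) (s t : seq nat).
Local Notation m := (n - d - 1).
Variable U : 'X_{1..n} -> Prop.
Hypothesis U_shifted : shifted_order_ideal m U.
Hypothesis U_degree : degree_at_most (d %/ 2) U.

Lemma member_in_first u : U u -> in_first m u.
Proof. by case: U_shifted => + _ _ _; apply. Qed.

Lemma member_degree u : U u -> 2 * mdeg u <= d.+1.
Proof. by move/U_degree; clear; move: (mdeg u); lia. Qed.

Lemma mon_preceq_nth u v : size (indices u) = size (indices v) ->
  (forall p, p < size (indices v) -> nth 0 (indices u) p <= nth 0 (indices v) p) ->
  mon_preceq u v.
Proof.
move=> sz_uv le_uv; rewrite /mon_preceq all2E sz_uv eqxx /=.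
apply/(all_nthP (0, 0)) => p; rewrite size_zip sz_uv minnn => lt_p.
by rewrite nth_zip //= le_uv.
Qed.

Lemma on_vertices_take k s : on_vertices n s -> on_vertices n (take k s).
Proof. by move=> /allP s_n; apply/allP=> c /mem_take/s_n. Qed.

Lemma member_refines u v : U u -> in_first m v ->
  refines (indices u) (indices v) -> U v.
Proof.
case: U_shifted => _ _ U_div U_prec Uu v_m [le_sz le_nth].
apply: (U_prec (mon n (take (size (indices v)) (indices u)))) => //.
  exact: U_div Uu (mon_take _ _).
have takeK: indices (mon n (take (size (indices v)) (indices u))) =
            take (size (indices v)) (indices u).
  by rewrite monK ?take_sorted ?indices_sorted ?on_vertices_take ?indices_on_vertices.
apply: mon_preceq_nth; rewrite takeK ?size_takel // => p lt_p.
by rewrite nth_take // le_nth.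
Qed.

Lemma sub_Fd u s : on_vertices n s -> vertex_set n s \subset Fd d u ->
  {subset s <= pairs (indices u) ++ tail_vertices n d (mdeg u)}.
Proof.
move=> s_n /subsetP sub c s_c; have /vertex_ord[j def_c] := allP s_n _ s_c.
by rewrite def_c -in_Fd // sub // inE -def_c.
Qed.

(** A face that contains the spread of v would make some monomial of U refine
    v, and then v would belong to U. *)
Lemma spread_nonface v : in_first m v -> on_vertices n (spread (indices v)) ->
  ~ U v -> ~ squeezed_ball d U (vertex_set n (spread (indices v))).
Proof.
move=> v_m s_n nUv [_ [u Uu ->] /(sub_Fd s_n) sub].
apply/nUv/(member_refines Uu v_m)/(spread_sub_refines lt_dn) => //.
exact: member_in_first.
Qed.

(** A numerical measure that grows strictly along the order used on facets, so
    that a facet with the largest potential is a maximal one. *)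
Definition potential s := sumn [seq n.+1 - c | c <- s].

Lemma refines_potential s t : on_vertices n s -> on_vertices n t ->
  refines t s -> potential s <= potential t ?= iff (s == t).
Proof.
move=> s_n t_n [le_sz le_nth].
suff [le_p eq_p]: potential s <= potential t /\ (potential s = potential t -> s = t).
  by split=> //; apply/eqP/eqP => [|-> //]; apply: eq_p.
elim: s => [|a s IHs] in t s_n t_n le_sz le_nth *.
  by case: t t_n {le_sz le_nth} => // b t /andP[b_n _]; rewrite /potential /=; lia.
case: t t_n le_sz le_nth => // b t /andP[b_n t_n] /= le_sz le_nth.
case/andP: s_n => a_n s_n.
have [||||le_p eq_p] := IHs t => // [p|]; first exact: (le_nth p.+1).
have /= le_ba := le_nth 0 isT; rewrite /potential /= -!/(potential _).
have le_ab: n.+1 - a <= n.+1 - b by rewrite leq_sub2l.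
split=> [|eq_ab]; first exact: leq_add.
have eq_st: potential s = potential t.
  by move: eq_ab le_p le_ab; clear; move: (potential s) (potential t); lia.
congr (_ :: _); last exact: eq_p.
by move: eq_ab le_ba a_n b_n; rewrite eq_st; clear; move: (potential t); lia.
Qed.

Lemma spread_sub_pairs s : {subset spread s <= pairs s}.
Proof. by move=> c /mem_spread[p lt_p def_c]; apply/mem_pairs; exists p; auto. Qed.

Lemma Fd_refines u w : U u -> U w -> vertex_set n (spread (indices u)) \subset Fd d w ->
  refines (indices w) (indices u).
Proof.
move=> Uu Uw sub.
have u_n: on_vertices n (spread (indices u)).
  have /allP pairs_n := pairs_on_vertices lt_dn (member_in_first Uu) (member_degree Uu).
  by apply/allP=> c /spread_sub_pairs c_in; apply: pairs_n; rewrite mem_cat c_in.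
apply: (spread_sub_refines lt_dn); [exact: member_in_first | exact: member_in_first |].
exact: sub_Fd.
Qed.

Lemma spread_sub_Fd u : vertex_set n (spread (indices u)) \subset Fd d u.
Proof.
apply/subsetP=> j; rewrite inE in_Fd // mem_cat => /spread_sub_pairs ->//.
Qed.

(** Facets have equally many vertices, so the containment is an equality; then
    each facet contains the spread of the other one, and refinement is
    antisymmetric. *)
Lemma Fd_inj u w : U u -> U w -> Fd d u \subset Fd d w -> u = w.
Proof.
move=> Uu Uw sub.
have eq_F: Fd d u = Fd d w.
  apply/eqP; rewrite eqEcard sub !card_Fd ?leqnn ?member_degree //.
    exact: member_in_first.
  exact: member_in_first.
have/refines_potential[]: refines (indices w) (indices u).
  by apply: Fd_refines => //; rewrite -eq_F spread_sub_Fd.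
1,2: exact: indices_on_vertices.
have/refines_potential[]: refines (indices u) (indices w).
  by apply: Fd_refines => //; rewrite eq_F spread_sub_Fd.
1,2: exact: indices_on_vertices.
move=> le1 _ le2 /esym/eqP.
rewrite eqn_leq le1 le2 => eq_i.
by rewrite -(indicesK u) -(indicesK w); congr (mon n _); apply/eqP; rewrite eq_i.
Qed.

Lemma Fd_facet u : U u -> facet (squeezed_ball d U) (Fd d u).
Proof.
move=> Uu; split; first by exists (Fd d u) => //; exists u.
move=> H [_ [w Uw ->] sub_H] sub; have sub_uw := subset_trans sub sub_H.
by apply/eqP; rewrite eqEsubset sub andbT (Fd_inj Uu Uw sub_uw).
Qed.

Lemma ball_facet F : facet (squeezed_ball d U) F -> exists2 u, U u & F = Fd d u.
Proof.
move=> [[_ [u Uu ->] sub] F_max]; exists u => //; apply/esym/F_max => //.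
by exists (Fd d u) => //; exists u.
Qed.

Lemma sphere_sub_ball F : squeezed_sphere d U F -> squeezed_ball d U F.
Proof.
case=> G [_ [H [[[[_ [u Uu ->] sub] _] subG] _]]] subF.
by exists (Fd d u); [exists u | apply: subset_trans subF (subset_trans subG sub)].
Qed.

(** Among the facets that contain C take one, F_d(u), of largest potential.
    Since C and the spread of u together have at most d elements, some vertex x
    of F_d(u) lies in neither.  A facet F_d(w) that contains F_d(u) without x
    contains C and the spread of u, so w refines u, and maximality gives w = u.
    Hence F_d(u) without x is a boundary face, and it contains C. *)
Lemma ball_sub_sphere C : squeezed_ball d U C -> #|C| <= d %/ 2 ->
  squeezed_sphere d U C.
Proof.
move=> [_ [u0 Uu0 ->] sub0] card_C.
pose P k := exists u, [/\ U u, C \subset Fd d u & potential (indices u) = k].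
have [||_ [u [Uu sub <-]] u_max] := @exists_max_nat P (n.+1 * d).
- by exists (potential (indices u0)), u0.
- move=> _ [u [/U_degree deg_u _ <-]].
  have: potential (indices u) <= n.+1 * size (indices u).
    rewrite /potential; elim: (indices u) => //= a s; lia.
  by rewrite size_indices; nia.
have card_u := card_Fd lt_dn (member_in_first Uu) (member_degree Uu).
have /subsetPn[x Fx]: ~~ (Fd d u \subset C :|: vertex_set n (spread (indices u))).
  apply/negP=> /subset_leq_card.
  have [+ _] := leq_card_setU C (vertex_set n (spread (indices u))).
  have: #|vertex_set n (spread (indices u))| <= mdeg u.
    by rewrite -size_indices -(size_spread (indices u)) card_vertex_set_leq.
  by have := U_degree Uu; rewrite card_u; lia.
rewrite inE negb_or => /andP[Cx spread_x].
(* C and the spread of u survive the removal of x. *)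
have sub_G (A : {set 'I_n}) : x \notin A -> A \subset Fd d u -> A \subset Fd d u :\ x.
  by move=> Ax sA; rewrite subsetD1 sA.
have C_G := sub_G _ Cx sub; exists (Fd d u :\ x) => //; split.
  by have := cardsD1 x (Fd d u); rewrite Fx card_u; lia.
exists (Fd d u); split=> [|F [/ball_facet[w Uw ->] sub_w]].
  by split; [exact: Fd_facet | apply: subsetDl].
have/refines_potential[]: refines (indices w) (indices u).
  apply: Fd_refines => //; apply: subset_trans sub_w.
  by apply: sub_G => //; apply: spread_sub_Fd.
1,2: exact: indices_on_vertices.
move=> le_p; rewrite eqn_leq le_p u_max /=; last first.
  by exists w; split=> //; apply: subset_trans sub_w.
move/esym/eqP=> eq_i; by rewrite -(indicesK u) eq_i indicesK.
Qed.
End Spheres.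

(** * Moving one index of a spread list *)

Section SpreadMoves.
Implicit Types s t : seq nat.

(** The exchange of one factor by which [exchange_space] passes from t to a
    smaller list. *)
Lemma spread_set_nth t (p b : nat) : (p < size t) ->
  perm_eq (b + 2 * p :: spread t) (nth 0 t p + 2 * p :: spread (set_nth 0 t p b)).
Proof.
move=> lt_p; have ->: spread (set_nth 0 t p b) = set_nth 0 (spread t) p (b + 2 * p).
  have sz : size (spread (set_nth 0 t p b)) = size (set_nth 0 (spread t) p (b + 2 * p)).
    by rewrite size_mkseq !size_set_nth size_mkseq.
  apply: (eq_from_nth (x0 := 0) sz) => q.
  rewrite size_mkseq size_set_nth (maxn_idPr lt_p) => lt_q.
  rewrite [LHS]nth_mkseq ?size_set_nth ?(maxn_idPr lt_p) //.
  rewrite (nth_set_nth _ (spread t)) nth_set_nth /=; case: eqP => [->|_] //.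
  by rewrite nth_mkseq.
apply/permP=> P; rewrite /= count_set_nth_ltn ?size_mkseq // nth_mkseq //.
have: (P (nth 0 t p + 2 * p) <= count P (spread t)).
  case PP: (P _) => //; rewrite -has_count; apply/hasP; exists (nth 0 t p + 2 * p) => //.
  by apply/mem_spread; exists p.
by move=> le_P; rewrite subnKC; [exact: addnC | exact: leq_trans le_P (leq_addr _ _)].
Qed.

(** The monomials that have the degree of the monomial of s and precede it, as
    lists. *)
Definition below s t := [/\ size t = size s, sorted leq t &
  forall p : nat, (p < size t) -> (0 < nth 0 t p <= nth 0 s p)].

Lemma below_on_vertices n s t : {in s, forall c, (c + 2 * size s <= n + 2)} ->
  below s t -> on_vertices n (spread t).
Proof.
move=> s_n [sz_t t_sorted t_s]; apply/allP=> c /mem_spread[p lt_p ->].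
have /andP[t_gt0 t_le] := t_s p lt_p; rewrite sz_t in lt_p.
have le_n : (nth 0 s p + 2 * size s <= n + 2) := s_n _ (mem_nth 0 lt_p).
by lia.
Qed.

Lemma spread_rcons t b : spread (rcons t b) = rcons (spread t) (b + 2 * size t).
Proof.
rewrite /spread size_rcons mkseqS nth_rcons ltnn eqxx; congr rcons.
apply: (@eq_from_nth _ 0); rewrite !size_mkseq // => p lt_p.
by rewrite !nth_mkseq // nth_rcons lt_p.
Qed.

(** A vertex outside all pairs falls between two consecutive ones, hence is of
    the form b + 2p where b can be put between t_(p-1) and t_p. *)
Lemma pairs_gap t c : sorted leq t -> (forall r, r < size t -> 0 < nth 0 t r) ->
  0 < c -> c \notin pairs t ->
  exists p, exists b, [/\ p <= size t, 0 < b, c = b + 2 * p,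
    p < size t -> b < nth 0 t p & 0 < p -> nth 0 t p.-1 <= b].
Proof.
move=> t_sorted t_gt0 c_gt0 pairs_c.
have gap r : r < size t -> nth 0 t r + 2 * r <= c -> nth 0 t r + 2 * r.+1 <= c.
  move=> lt_r le_r.
  have: nth 0 t r + 2 * r != c.
    by apply: contraNneq pairs_c => <-; apply/mem_pairs; exists r; auto.
  have: nth 0 t r + 2 * r + 1 != c.
    by apply: contraNneq pairs_c => <-; apply/mem_pairs; exists r; auto.
  by lia.
pose p := find (fun a => c < a) (spread t).
have le_p: p <= size t by rewrite -size_spread find_size.
have p_min r : r < p -> nth 0 t r + 2 * r.+1 <= c.
  move=> lt_r; have lt_rt := leq_trans lt_r le_p.
  by apply: gap => //; have := before_find 0 lt_r; rewrite nth_mkseq // ltnNge => /negbFE.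
have lt_c: p < size t -> c < nth 0 t p + 2 * p.
  move=> lt_p; have := @nth_find _ 0 (fun a => c < a) (spread t).
  by rewrite has_find size_spread -/p nth_mkseq //; apply.
exists p, (c - 2 * p); case: p => [|p] in le_p p_min lt_c *; split=> //; try by lia.
- by have := p_min p (ltnSn p); have := t_gt0 p le_p; lia.
- by have := p_min p (ltnSn p); lia.
- by move=> lt_p; have := lt_c lt_p; have := p_min p (ltnSn p); lia.
by move=> _ /=; have := p_min p (ltnSn p); lia.
Qed.

Lemma below_rcons s t m b : below s t -> 0 < b <= m ->
  (0 < size t -> nth 0 t (size t).-1 <= b) -> below (rcons s m) (rcons t b).
Proof.
move=> [sz_t /(sortedP 0) t_sorted t_s] b_m le_b; split.
- by rewrite !size_rcons sz_t.
- apply/(sortedP 0) => r; rewrite size_rcons ltnS => lt_r.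
  rewrite !nth_rcons lt_r; case: (ltngtP r.+1) lt_r => // [lt_r1 _|eq_r _].
    exact: t_sorted.
  by move: le_b; rewrite -eq_r; apply.
move=> r; rewrite size_rcons !nth_rcons -sz_t ltnS => le_r.
case: (ltngtP r) le_r => // lt_r _; exact: t_s.
Qed.

Lemma below_set_nth s t p b : below s t -> p < size t -> 0 < b < nth 0 t p ->
  (0 < p -> nth 0 t p.-1 <= b) -> below s (set_nth 0 t p b).
Proof.
move=> [sz_t /(sortedP 0) t_sorted t_s] lt_p /andP[b_gt0 lt_b] le_b.
have sz: size (set_nth 0 t p b) = size t by rewrite size_set_nth (maxn_idPr lt_p).
split; rewrite ?sz //.
- apply/(sortedP 0) => r; rewrite sz => lt_r; rewrite !nth_set_nth /=.
  have := t_sorted r lt_r; case: (r =P p) => [eq_rp|ne_rp].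
    by rewrite ifF; [rewrite -eq_rp in lt_b; lia | lia].
  by case: (r.+1 =P p) => // eq_p _; move: le_b; rewrite -eq_p; apply.
move=> r lt_r; rewrite nth_set_nth /=; have := t_s r lt_r.
by case: eqP => // ->; lia.
Qed.

Lemma sumn_set_nth_lt t p b : p < size t -> b < nth 0 t p ->
  sumn (set_nth 0 t p b) < sumn t.
Proof.
move=> lt_p lt_b; rewrite sumn_set_nth_ltn //.
have: nth 0 t p <= sumn t; last by lia.
elim: t p lt_p {lt_b} => //= a t IHt [|p] lt_p; first by rewrite /= leq_addr.
by apply: leq_trans (IHt _ lt_p) (leq_addl _ _).
Qed.

End SpreadMoves.

(** * Initial monomials after a linear change of coordinates *)

Section RevLex.
Variable n : nat.
Implicit Types u v w : 'X_{1..n}.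

Lemma drl_ltP u v : reflect
  (mdeg u < mdeg v \/ mdeg u = mdeg v /\ exists2 i : 'I_n, v i < u i &
     forall j : 'I_n, i < j -> u j = v j) (drl_lt u v).
Proof.
apply: (iffP orP) => -[lt_uv|]; try by left.
  case/andP=> /eqP eq_uv /existsP[i /andP[lt_i /forallP eq_j]].
  by right; split=> //; exists i => // j lt_j; apply/eqP/(implyP (eq_j j)).
case=> eq_uv [i lt_i eq_j]; right; rewrite eq_uv eqxx; apply/existsP; exists i.
by rewrite lt_i; apply/forallP=> j; apply/implyP=> /eq_j->.
Qed.

Lemma drl_lt_mdeg u v : drl_lt u v -> mdeg u <= mdeg v.
Proof. by case/drl_ltP=> [/ltnW|[->]]. Qed.

Lemma drl_ltnn u : drl_lt u u = false.
Proof. by apply/drl_ltP=> -[|[_ [i]]]; rewrite ltnn. Qed.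

Lemma drl_lt_trans : transitive (@drl_lt n).
Proof.
move=> v u w /drl_ltP uv /drl_ltP vw; apply/drl_ltP.
case: uv vw => [lt_uv|[-> [i lt_i eq_i]]] [lt_vw|[<- [j lt_j eq_j]]]; try by left.
- by left; apply: ltn_trans lt_vw.
right; split=> //; case: (ltngtP i j) => [lt_ij|lt_ji|/val_inj eq_ij].
- exists j => [|l lt_l]; first by rewrite eq_i.
  by rewrite eq_i ?eq_j //; apply: ltn_trans lt_l.
- exists i => [|l lt_l]; first by rewrite -eq_j.
  by rewrite eq_i ?eq_j //; apply: ltn_trans lt_l.
exists i => [|l lt_l]; last by rewrite eq_i ?eq_j // -eq_ij.
by apply: ltn_trans lt_i; rewrite eq_ij.
Qed.

Lemma drl_lt_total u v : u != v -> drl_lt u v || drl_lt v u.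
Proof.
move=> ne_uv; case: (ltngtP (mdeg u) (mdeg v)) => [lt|lt|eq_d].
- by apply/orP; left; apply/drl_ltP; left.
- by apply/orP; right; apply/drl_ltP; left.
have /existsP[i0 ne_i0]: [exists i, u i != v i].
  by apply: contraR ne_uv => /existsPn eq_uv; apply/eqP/mnmP=> i; apply/eqP/negbNE.
case: (@arg_maxnP _ i0 (fun i => u i != v i) val ne_i0) => i ne_i i_max.
have eq_j (j : 'I_n) : i < j -> u j = v j.
  by move=> lt_ij; apply/eqP; apply: contraLR lt_ij => /i_max; rewrite -leqNgt.
case: (ltngtP (u i) (v i)) ne_i => // lt_i _; apply/orP; [right|left].
  by apply/drl_ltP; right; split=> //; exists i => // j /eq_j.
by apply/drl_ltP; right; split=> //; exists i.
Qed.

Lemma drl_lt_add w u v : drl_lt u v -> drl_lt (u + w)%MM (v + w)%MM.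
Proof.
move/drl_ltP=> uv; apply/drl_ltP; rewrite !mdegD ltn_add2r.
case: uv => [|[-> [i lt_i eq_j]]]; first by left.
right; split=> //.
exists i => [|j /eq_j eq_uv]; first by rewrite !mnmDE ltn_add2r.
by rewrite !mnmDE eq_uv.
Qed.

(** Within one degree the last variable with different exponents decides.  This
    is the property of the order on which [initial_of_spreads] rests: a term that
    uses a late variable is small. *)
Lemma drl_lt_first k u v : mdeg v <= mdeg u -> in_first k u -> ~ in_first k v ->
  drl_lt v u.
Proof.
move=> le_d u_k v_k; apply/drl_ltP; case: ltngtP le_d => // [|eq_d] _; first by left.
right; split=> //; have [i0 v_i0] := not_all_ex_not _ _ v_k.
have [le_i0 /eqP ne_i0] := imply_to_and _ _ v_i0.
case: (@arg_maxnP _ i0 (fun i => v i != 0) val ne_i0) => i ne_i i_max.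
have le_i: k <= i by apply: leq_trans le_i0 _; apply: i_max.
exists i => [|j lt_ij]; first by rewrite u_k // lt0n.
rewrite [RHS]u_k; last by apply: leq_trans le_i (ltnW _).
by apply/eqP; apply: contraLR lt_ij => /i_max; rewrite -leqNgt.
Qed.

End RevLex.

Local Open Scope ring_scope.

Section Initial.
Variables (K : fieldType) (n : nat).
Implicit Types (u v w b : 'X_{1..n}) (p q : {mpoly K[n]}) (g : 'M[K]_n).
Implicit Types (N : 'X_{1..n} -> Prop).

Lemma is_initialP p u : is_initial p u <->
  p@_u != 0 /\ forall v, v != u -> ~~ drl_lt v u -> p@_v = 0.
Proof.
rewrite /is_initial mcoeff_msupp; split=> -[pu lt_p]; split=> // v.
  move=> ne_vu; apply: contraNeq; rewrite -mcoeff_msupp => p_v; exact: lt_p.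
by rewrite mcoeff_msupp => nz_v ne_vu; apply: contraNT nz_v => /lt_p->.
Qed.

Lemma is_initialMX p u w : is_initial p u -> is_initial (p * 'X_[w]) (u + w)%MM.
Proof.
case=> p_u lt_p.
have supp v : (v \in msupp (p * 'X_[w])) = (v \in [seq (w + m)%MM | m <- msupp p]).
  exact/perm_mem/msuppMX.
split; first by rewrite supp addmC map_f.
move=> v; rewrite supp => /mapP[b p_b ->].
by rewrite addmC eqm_add2r => /(lt_p _ p_b)/drl_lt_add.
Qed.

Lemma is_initial_mdeg p u v : is_initial p u -> v \in msupp p -> (mdeg v <= mdeg u)%N.
Proof.
by case=> _ lt_p p_v; case: (eqVneq v u) => [->//|/(lt_p _ p_v)/drl_lt_mdeg].
Qed.

Definition monomial_ideal N p := forall b, b \in msupp p -> N b.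

(** u is the initial monomial of an element of g(I), where I is the monomial
    ideal of the polynomials supported on N.  A variant rather than a defined
    constant keeps conversion from comparing linear changes of coordinates. *)
Variant initial_monomial g N u : Prop :=
  InitialMonomial q of monomial_ideal N q & is_initial (lin_change g q) u.

Definition vertices u : {set 'I_n} := [set i | (0 < u i)%N].
Definition indicator (F : {set 'I_n}) : 'X_{1..n} := [multinom (i \in F : nat) | i < n].

Lemma mpolyX_indicator F : 'X_[indicator F] = \prod_(i in F) 'X_i :> {mpoly K[n]}.
Proof.
rewrite mpolyXE_id [RHS]big_mkcond; apply: eq_bigr => i _.
by rewrite mnmE; case: (i \in F).
Qed.

Lemma indicator_vertices u : (indicator (vertices u) <= u)%MM.
Proof. by apply/mnm_lepP=> i; rewrite mnmE inE; case: (u i). Qed.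

(** Each term of p is a multiple of the squarefree monomial of its own
    variables, and sets that contain a nonface are nonfaces. *)
Lemma stanley_reisnerP (C : {set 'I_n} -> Prop) p :
  (forall F H : {set 'I_n}, C H -> F \subset H -> C F) ->
  stanley_reisner K C p <-> monomial_ideal (fun b => ~ C (vertices b)) p.
Proof.
move=> C_down; split=> [[s s_gen ->]|Np].
  move=> b /msupp_sum_le/flattenP[supp_c /mapP[c]].
  rewrite mem_filter => /= s_c ->{supp_c}.
  have [F nCF ->] := s_gen _ s_c; rewrite -mpolyX_indicator.
  rewrite (perm_mem (msuppMX _ _)) => /mapP[a _ ->] Cb; apply: nCF.
  apply: C_down Cb _; apply/subsetP=> i Fi.
  by rewrite inE mnmDE mnmE Fi.
exists [seq (p@_b *: 'X_[b - indicator (vertices b)],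
             \prod_(i in vertices b) 'X_i) | b <- msupp p].
  by move=> _ /mapP[b p_b ->]; exists (vertices b); rewrite // => Cb; apply: Np p_b Cb.
rewrite big_map [LHS]mpolyE; apply: eq_bigr => b _ /=.
by rewrite -mpolyX_indicator -scalerAl -mpolyXD submK // indicator_vertices.
Qed.

Lemma lin_changeD g : {morph lin_change g : p q / p + q}.
Proof. exact: comp_mpolyD. Qed.
Lemma lin_changeZ g c p : lin_change g (c *: p) = c *: lin_change g p.
Proof. exact: comp_mpolyZ. Qed.
Lemma lin_changeM g : {morph lin_change g : p q / p * q}.
Proof. exact: rmorphM. Qed.
Lemma lin_changeX g j : lin_change g 'X_j = \sum_(i < n) g i j *: 'X_i.
Proof. by rewrite /lin_change comp_mpolyXU -tnth_nth tnth_mktuple. Qed.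
Lemma lin_changeE g p :
  lin_change g p = \sum_(b <- msupp p) p@_b *: lin_change g 'X_[b].
Proof. exact: comp_mpolyEX. Qed.
Lemma lin_change_prod g b :
  lin_change g 'X_[b] = \prod_(j < n) (\sum_(i < n) g i j *: 'X_i) ^+ b j.
Proof.
by rewrite /lin_change comp_mpolyX; apply: eq_bigr => i _; rewrite tnth_mktuple.
Qed.

Lemma lin_change_homog g b : lin_change g 'X_[b] \is (mdeg b).-homog.
Proof.
rewrite lin_change_prod mdegE.
apply: (big_ind2 (fun p k => p \is k.-homog)) => [|p k q l|j _].
- exact: dhomog1.
- exact: dhomogM.
rewrite -[X in X.-homog]mul1n; apply: dhomogMn.
by apply: rpred_sum => i _; apply: dhomogZ; rewrite dhomogX /= mdeg1.
Qed.

Lemma mcoeff_lin_change g b w : mdeg w != mdeg b -> (lin_change g 'X_[b])@_w = 0.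
Proof. by move=> ne; apply: (dhomog_nemf_coeff (lin_change_homog g b)). Qed.

Definition truncate e p := \sum_(b <- msupp p | (mdeg b <= e)%N) p@_b *: 'X_[b].

Lemma msupp_truncate e p b :
  b \in msupp (truncate e p) -> b \in msupp p /\ (mdeg b <= e)%N.
Proof.
move/msupp_sum_le/flattenP=> [supp_c /mapP[c]]; rewrite mem_filter.
case/andP=> le_c p_c ->{supp_c}.
by move/msuppZ_le; rewrite msuppX inE => /eqP->.
Qed.

(** A linear change of coordinates preserves degrees, so the terms of q above
    the degree of the initial monomial cancel in the image and may be dropped. *)
Lemma lin_change_truncate g q u : is_initial (lin_change g q) u ->
  lin_change g (truncate (mdeg u) q) = lin_change g q.
Proof.
move=> init_u; apply/mpolyP=> w.
case: (leqP (mdeg w) (mdeg u)) => [le_wu|lt_uw].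
  rewrite [in RHS]lin_changeE [lin_change _ _]linear_sum !raddf_sum /= big_mkcond.
  apply: eq_bigr => b _; case: leqP => [_|lt_ub]; first by rewrite comp_mpolyZ.
  rewrite mcoeffZ mcoeff_lin_change ?mulr0 //.
  by rewrite neq_ltn (leq_ltn_trans le_wu).
rewrite [RHS](memN_msupp_eq0); last first.
  by apply/negP=> /(is_initial_mdeg init_u); rewrite leqNgt lt_uw.
rewrite [lin_change _ _]linear_sum raddf_sum /=; apply: big1 => b le_b.
rewrite comp_mpolyZ mcoeffZ mcoeff_lin_change ?mulr0 //.
by rewrite neq_ltn (leq_ltn_trans le_b) ?orbT.
Qed.

Lemma lin_changeMl g h p : lin_change g (lin_change h p) = lin_change (g *m h) p.
Proof.
rewrite [lin_change h p]lin_changeE [RHS]lin_changeE [LHS]linear_sum /=.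
apply: eq_bigr => b _; rewrite comp_mpolyZ -/(lin_change _ _) !lin_change_prod.
congr (_ *: _); rewrite /lin_change rmorph_prod /=; apply: eq_bigr => j _.
rewrite rmorphXn /=; congr (_ ^+ _); rewrite linear_sum /=.
under eq_bigr => i _ do rewrite comp_mpolyZ -/(lin_change g _) lin_changeX scaler_sumr.
rewrite exchange_big /=; apply: eq_bigr => k _; rewrite mxE scaler_suml.
by apply: eq_bigr => i _; rewrite scalerA mulrC.
Qed.

Lemma lin_change1 p : lin_change 1%:M p = p.
Proof.
rewrite -[RHS]comp_mpoly_id; congr (_ \mPo _); apply: eq_from_tnth => j.
rewrite !tnth_mktuple (bigD1 j) //= mxE eqxx scale1r big1 ?addr0 // => i ne_ij.
by rewrite mxE (negPf ne_ij) scale0r.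
Qed.

Lemma monomial_idealM N p q : (forall u v, N u -> (u <= v)%MM -> N v) ->
  monomial_ideal N p -> monomial_ideal N (p * q).
Proof.
move=> N_up Np b /msuppM_le/allpairsP[[u v] [/= /Np Nu _ ->]].
by apply: N_up Nu (lem_addr _ _).
Qed.

(** The multiple p x^b of an element p of g(I) is again in g(I) because x^b is
    itself the image of a polynomial, g being invertible. *)
Lemma initial_monomial_up g N u w : (forall u v, N u -> (u <= v)%MM -> N v) ->
  g \in unitmx -> initial_monomial g N u -> (u <= w)%MM -> initial_monomial g N w.
Proof.
move=> N_up g_unit [q Nq init_u] le_uw.
exists (q * lin_change (invmx g) 'X_[w - u]); first exact: monomial_idealM.
rewrite lin_changeM lin_changeMl mulmxV // lin_change1.
by rewrite -[X in is_initial _ X](submK le_uw) addmC; apply: is_initialMX.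
Qed.

Lemma initial_ideal_monomial g N u : (forall u v, N u -> (u <= v)%MM -> N v) ->
  g \in unitmx ->
  initial_ideal (lin_change_ideal g (monomial_ideal N)) 'X_[u] <->
  initial_monomial g N u.
Proof.
move=> N_up g_unit; split=> [[s s_gen Xu]|[q Nq init_u]]; last first.
  exists [:: (1, 'X_[u])]; last by rewrite big_seq1 mul1r.
  by move=> c; rewrite inE => /eqP->; exists (lin_change g q), u; split=> //; exists q.
have: u \in msupp ('X_[u] : {mpoly K[n]}) by rewrite msuppX inE.
rewrite Xu => /msupp_sum_le/flattenP[supp_c /mapP[c]].
rewrite mem_filter => /= s_c ->{supp_c}.
have [p [v [[q Nq ->] init_v ->]]] := s_gen _ s_c.
rewrite (perm_mem (msuppMX _ _)) => /mapP[a _ ->].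
by apply: initial_monomial_up (lem_addr _ _) => //; exists q.
Qed.

Lemma initial_ideal_eq g h N :
  (forall u, initial_monomial g N u <-> initial_monomial h N u) ->
  forall q, initial_ideal (lin_change_ideal g (monomial_ideal N)) q <->
            initial_ideal (lin_change_ideal h (monomial_ideal N)) q.
Proof.
suff imp g1 g2 : (forall u, initial_monomial g1 N u -> initial_monomial g2 N u) ->
    forall q, initial_ideal (lin_change_ideal g1 (monomial_ideal N)) q ->
    initial_ideal (lin_change_ideal g2 (monomial_ideal N)) q.
  by move=> gh q; split; apply: imp => u /gh.
move=> imp q [s s_gen def_q]; exists s => // c /s_gen[p [u [[r Nr def_p] init_u ->]]].
have [|r' Nr' init'] := imp u; first by exists r; rewrite -?def_p.
by exists (lin_change g2 r'), u; split=> //; exists r'.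
Qed.

End Initial.

(** * Polynomial functions of a matrix, and generic matrices *)

Section PolynomialFunctions.
Variables (K : fieldType) (n : nat).
Implicit Types (F G : 'M[K]_n -> K) (g : 'M[K]_n).

Definition polyfun F := exists f : {mpoly K[n * n]}, forall g, F g = f.@[mxvec g 0].

Lemma polyfun_const c : polyfun (fun=> c).
Proof. by exists c%:MP => g; rewrite mevalC. Qed.

Lemma polyfun_entry i j : polyfun (fun g => g i j).
Proof. by exists 'X_(mxvec_index i j) => g; rewrite mevalXU mxvecE. Qed.

Lemma polyfunM F G : polyfun F -> polyfun G -> polyfun (fun g => F g * G g).
Proof. by move=> [f Ff] [h Gh]; exists (f * h) => g; rewrite mevalM Ff Gh. Qed.

Lemma polyfun_sum (I : Type) (r : seq I) (P : pred I) (F : I -> 'M[K]_n -> K) :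
  (forall i, polyfun (F i)) -> polyfun (fun g => \sum_(i <- r | P i) F i g).
Proof.
move=> poly_F; elim: r => [|i r [f IHr]].
  by exists 0 => g; rewrite big_nil meval0.
have [h Fh] := poly_F i; exists (if P i then h + f else f) => g.
by rewrite big_cons; case: (P i); rewrite ?mevalD ?Fh IHr.
Qed.

Lemma polyfun_prod (I : Type) (r : seq I) (P : pred I) (F : I -> 'M[K]_n -> K) :
  (forall i, polyfun (F i)) -> polyfun (fun g => \prod_(i <- r | P i) F i g).
Proof.
move=> poly_F; elim: r => [|i r [f IHr]].
  by exists 1 => g; rewrite big_nil meval1.
have [h Fh] := poly_F i; exists (if P i then h * f else f) => g.
by rewrite big_cons; case: (P i); rewrite ?mevalM ?Fh IHr.
Qed.

Lemma polyfun_det r (A : 'M[K]_n -> 'M[K]_r) :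
  (forall i j, polyfun (fun g => A g i j)) -> polyfun (fun g => \det (A g)).
Proof.
move=> poly_A; apply: polyfun_sum => s; apply: polyfunM; first exact: polyfun_const.
by apply: polyfun_prod => i; apply: poly_A.
Qed.

Lemma polyfun_mulmx r s t (A : 'M[K]_n -> 'M[K]_(r, s)) (B : 'M[K]_n -> 'M[K]_(s, t)) :
  (forall i j, polyfun (fun g => A g i j)) ->
  (forall i j, polyfun (fun g => B g i j)) ->
  forall i j, polyfun (fun g => (A g *m B g) i j).
Proof.
move=> poly_A poly_B i j.
have [f Ff]: polyfun (fun g => \sum_k A g i k * B g k j).
  by apply: polyfun_sum => k; apply: polyfunM.
by exists f => g; rewrite mxE Ff.
Qed.

Lemma polyfun_lin_change b w : polyfun (fun g => (lin_change g 'X_[b])@_w).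
Proof.
pose pf (p : 'M[K]_n -> {mpoly K[n]}) := forall v, polyfun (fun g => (p g)@_v).
have pfM p q : pf p -> pf q -> pf (fun g => p g * q g).
  move=> pf_p pf_q v; have [f Ff]: polyfun (fun g =>
      \sum_(k : 'X_{1..n < (mdeg v).+1, (mdeg v).+1} | v == (k.1 + k.2)%MM)
        ((p g)@_k.1 * (q g)@_k.2)).
    by apply: polyfun_sum => k; apply: polyfunM.
  by exists f => g; rewrite mcoeffM Ff.
have pf1 : pf (fun=> 1) by move=> v; apply: polyfun_const.
suff pf_X : pf (fun g => lin_change g 'X_[b]) by apply: pf_X.
suff [p pf_p def_p] : exists2 p, pf p & forall g, lin_change g 'X_[b] = p g.
  by move=> v; have [f Ff] := pf_p v; exists f => g; rewrite def_p Ff.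
exists (fun g => \prod_(j < n) (\sum_(i < n) g i j *: 'X_i) ^+ b j); last first.
  by move=> g; rewrite lin_change_prod.
(* The induction runs over the outer product only, not over the inner sums. *)
suff pf_r r : pf (fun g => \prod_(j <- r) (\sum_(i < n) g i j *: 'X_i) ^+ b j).
  exact: pf_r.
elim: r => [|j r IHr].
  by move=> v; have [f Ff] := pf1 v; exists f => g; rewrite big_nil -Ff.
suff pf_j: pf (fun g => (\sum_(i < n) g i j *: 'X_i) ^+ b j).
  by move=> v; have [f Ff] := pfM _ _ pf_j IHr v; exists f => g; rewrite big_cons Ff.
elim: (b j) => [|k IHk]; first exact: pf1.
suff pf_l: pf (fun g => \sum_(i < n) g i j *: 'X_i).
  by move=> v; have [f Ff] := pfM _ _ pf_l IHk v; exists f => g; rewrite exprS Ff.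
move=> v; have [f Ff]: polyfun (fun g => \sum_(i < n) g i j * ('X_i : {mpoly K[n]})@_v).
  apply: polyfun_sum => i; apply: polyfunM; first exact: polyfun_entry.
  exact: polyfun_const.
exists f => g; rewrite -Ff raddf_sum /=; apply: eq_bigr => i _; exact: mcoeffZ.
Qed.

Definition generically_nz F := polyfun F /\ exists g, F g != 0.

Lemma meval_line N (f : {mpoly K[N]}) (x y : 'I_N -> K) :
  exists P : {poly K}, forall t, f.@[fun i => x i + t * y i] = P.[t].
Proof.
elim/mpolyind: f => [|c b p _ _ [P defP]].
  by exists 0 => t; rewrite meval0 horner0.
exists (c%:P * \prod_i ((x i)%:P + 'X * (y i)%:P) ^+ b i + P) => t.
rewrite mevalD mevalZ mevalX defP hornerD hornerM hornerC horner_prod.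
congr (_ * _ + _); apply: eq_bigr => i _.
by rewrite horner_exp hornerD hornerM !hornerC hornerX.
Qed.

Hypothesis Kinfinite : forall s : seq K, exists x : K, x \notin s.

Lemma poly_nonroot (P : {poly K}) : P != 0 -> exists t, P.[t] != 0.
Proof.
move=> nzP; suff [s [uniq_s size_s]]: exists s : seq K, uniq s /\ size s = size P.
  have/allPn[t _ nz_t]: ~~ all (root P) s.
    by apply/negP=> /(max_poly_roots nzP)/(_ uniq_s); rewrite size_s ltnn.
  by exists t.
elim: (size P) => [|k [s [uniq_s size_s]]]; first by exists [::].
by have [x s'x] := Kinfinite s; exists (x :: s); rewrite /= s'x size_s.
Qed.

(** Restrict both functions to the line through a point where the first does
    not vanish and a point where the second does not: their product becomes a
    nonzero polynomial in one variable, which has a nonroot as K is infinite. *)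
Lemma generically_nzM F G : generically_nz F -> generically_nz G ->
  generically_nz (fun g => F g * G g).
Proof.
move=> [poly_F [g0 nzF]] [poly_G [g1 nzG]]; split; first exact: polyfunM.
have line H : polyfun H -> exists P : {poly K}, forall t, H (g0 + t *: (g1 - g0)) = P.[t].
  case=> h defH; have [P defP] := meval_line h (mxvec g0 0) (mxvec (g1 - g0) 0).
  exists P => t; rewrite defH -defP; apply: meval_eq => i.
  by rewrite linearD linearZ !mxE.
have [P defP] := line F poly_F; have [Q defQ] := line G poly_G.
have nzP: P != 0.
  by apply: contraNneq nzF => P0; have:= defP 0; rewrite scale0r addr0 P0 horner0 => ->.
have nzQ: Q != 0.
  apply: contraNneq nzG => Q0; have:= defQ 1.
  by rewrite scale1r addrC subrK Q0 horner0 => ->.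
have [|t] := @poly_nonroot (P * Q); first by rewrite mulf_neq0.
by rewrite hornerM -defP -defQ => nz_t; exists (g0 + t *: (g1 - g0)).
Qed.

Lemma generically_nz_prod (I : Type) (r : seq I) (F : I -> 'M[K]_n -> K) :
  (forall i, generically_nz (F i)) -> generically_nz (fun g => \prod_(i <- r) F i g).
Proof.
move=> nzF; elim: r => [|i r [IHp [g IHg]]].
  split; first by apply: polyfun_prod => i; case: (nzF i).
  by exists 0; rewrite big_nil oner_neq0.
split; first by apply: polyfun_prod => j; case: (nzF j).
have [_ [h]] := generically_nzM (nzF i) (conj IHp (ex_intro _ g IHg)).
by exists h; rewrite big_cons.
Qed.

Lemma generically_nz_det : generically_nz (fun g => \det g).
Proof.
split; first by apply: polyfun_det => i j; apply: polyfun_entry.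
by exists 1%:M; rewrite det1 oner_neq0.
Qed.

(** Lower semicontinuity of the rank, witnessed by one minor up to fixed
    changes of bases. *)
Lemma rank_generic r s (A : 'M[K]_n -> 'M[K]_(r, s)) g0 :
  (forall i j, polyfun (fun g => A g i j)) ->
  exists2 F, polyfun F /\ F g0 != 0 &
    forall g, F g != 0 -> (\rank (A g0) <= \rank (A g))%N.
Proof.
move=> poly_A.
have [L defL] := row_fullP (col_base_full (A g0)).
have [R defR] := row_freeP (row_base_free (A g0)).
exists (fun g => \det (L *m A g *m R)); first split.
- apply: polyfun_det; apply: polyfun_mulmx => [|i j]; last exact: polyfun_const.
  by apply: polyfun_mulmx => // i j; apply: polyfun_const.
- rewrite (_ : _ *m R = 1%:M) ?det1 ?oner_neq0 // -defR -[row_base _]mul1mx -defL.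
  by rewrite -(mulmxA L (col_base _)) mulmx_base.
move=> g; rewrite -unitfE -unitmxE => /mxrank_unit <-.
by rewrite (leq_trans (mxrankM_maxl _ _)) // mxrankM_maxr.
Qed.

Lemma card_leq_ord (A : {set 'I_n}) : (#|A| <= n)%N.
Proof. by rewrite -[X in (_ <= X)%N]card_ord max_card. Qed.

Definition lead_rows (A : {set 'I_n}) : 'I_#|A| -> 'I_n := widen_ord (card_leq_ord A).

Definition minor g (A : {set 'I_n}) :=
  \matrix_(a, b < #|A|) g (lead_rows a) (enum_val b).

(** The minors on the first rows and arbitrary columns do not vanish.  Columns
    are the images of the variables, so any r of these images are linearly
    independent after x_(r+1), ..., x_n are set to 0. *)
Definition generic g := forall A : {set 'I_n}, \det (minor g A) != 0.

(** The minor on the columns A takes the value 1 at a matrix whose entry in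
    row i and column j is 1 exactly when j is the i-th element of A. *)
Lemma generic_dense : exists2 F, generically_nz F & forall g, F g != 0 -> generic g.
Proof.
exists (fun g => \prod_(A : {set 'I_n}) \det (minor g A)).
  apply: generically_nz_prod => A; split.
    apply: polyfun_det => a b.
    have [f Ff] := polyfun_entry (lead_rows a) (enum_val b).
    by exists f => g; rewrite mxE Ff.
  exists (\matrix_(i, j) (val i == index j (enum A))%:R).
  rewrite (_ : minor _ _ = 1%:M) ?det1 ?oner_neq0 //.
  apply/matrixP=> a b; rewrite !mxE.
  by rewrite /enum_val index_uniq ?enum_uniq -?cardE.
by move=> g /prodf_neq0 nz A; apply: nz.
Qed.

Variable g : 'M[K]_n.
Hypothesis g_generic : generic g.

Lemma sum_lead_rows (A : {set 'I_n}) (F : 'I_n -> K) :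
  (forall i : 'I_n, (#|A| <= i)%N -> F i = 0) ->
  \sum_i F i = \sum_(a < #|A|) F (lead_rows a).
Proof.
move=> F0; rewrite (bigID (fun i : 'I_n => (i < #|A|)%N)) /= addrC big1 ?add0r.
  by rewrite (big_ord_narrow (card_leq_ord A)).
by move=> i; rewrite -leqNgt => /F0.
Qed.

Lemma generic_solve (A : {set 'I_n}) (z : 'I_n -> K) :
  exists2 y : 'I_n -> K, (forall i : 'I_n, (#|A| <= i)%N -> y i = 0) &
    {in A, forall j, \sum_i y i * g i j = z j}.
Proof.
have gA: minor g A \in unitmx by rewrite unitmxE unitfE g_generic.
pose Y := \row_b z (enum_val b) *m invmx (minor g A).
exists (fun i => if insub (val i) is Some a then Y 0 a else 0).
  by move=> i le_i; rewrite insubN // -leqNgt.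
move=> j Aj; rewrite (@sum_lead_rows A) => [|i le_i]; last first.
  by rewrite insubN ?mul0r // -leqNgt.
have /rowP/(_ (enum_rank_in Aj j)): Y *m minor g A = \row_b z (enum_val b).
  by rewrite mulmxKV.
rewrite !mxE enum_rankK_in // => <-; apply: eq_bigr => a _.
rewrite [minor _ _ _ _]mxE enum_rankK_in //=; congr (_ * _).
by rewrite (_ : insub _ = Some a) //= insubT //= => lt_a; congr Some; apply: val_inj.
Qed.

Lemma generic_annihilator (A : {set 'I_n}) (y : 'I_n -> K) :
  (forall i : 'I_n, (#|A| <= i)%N -> y i = 0) ->
  {in A, forall j, \sum_i y i * g i j = 0} -> forall i, y i = 0.
Proof.
move=> y0 yA.
have gA: minor g A \in unitmx by rewrite unitmxE unitfE g_generic.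
have Y0: \row_a y (lead_rows a) *m minor g A = 0.
  apply/rowP=> b; rewrite !mxE -[RHS](yA (enum_val b)) ?enum_valP //.
  rewrite (@sum_lead_rows A) => [|i le_i]; last by rewrite y0 ?mul0r.
  by apply: eq_bigr => a _; rewrite !mxE.
move=> i; case: (ltnP i #|A|) => [lt_i|]; last exact: y0.
have: \row_a y (lead_rows (A := A) a) = 0.
  by rewrite -[\row_a _](mulmxK gA) Y0 mul0mx.
by move/rowP/(_ (Ordinal lt_i)); rewrite !mxE => <-; congr y; apply: val_inj.
Qed.

Lemma generic_span (A : {set 'I_n}) (h : 'I_n -> K) :
  exists2 l : 'I_n -> K, (forall j, j \notin A -> l j = 0) &
    forall i : 'I_n, (i < #|A|)%N -> \sum_j l j * g i j = h i.
Proof.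
have gA: minor g A \in unitmx by rewrite unitmxE unitfE g_generic.
pose Y := invmx (minor g A) *m \col_a h (lead_rows a).
exists (fun j => \sum_(b | enum_val b == j) Y b 0).
  by move=> j A'j; apply: big1 => b /eqP def_j; rewrite -def_j enum_valP in A'j.
move=> i lt_i; have /colP/(_ (Ordinal lt_i)): minor g A *m Y = \col_a h (lead_rows a).
  by rewrite mulKVmx.
rewrite !mxE (_ : lead_rows _ = i) => [<-|]; last exact: val_inj.
rewrite (eq_bigr _ (fun j _ => mulr_suml _ _ _ _)) (exchange_big_dep predT) //=.
apply: eq_bigr => b _; rewrite (big_pred1 (enum_val b)) => [|j]; last by rewrite /= eq_sym.
by rewrite mulrC [minor _ _ _ _]mxE; congr (g _ _ * _); apply: val_inj.
Qed.

End PolynomialFunctions.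

(** * Initial monomials produced by spread products *)

Section KeyLemma.
Variables (K : fieldType) (n : nat) (g : 'M[K]_n).
Hypothesis g_generic : generic g.
Implicit Types (s t : seq nat) (W : {mpoly K[n]} -> Prop).

(** Equality modulo the variables x_(k+1), ..., x_n. *)
Definition eq_first k (p q : {mpoly K[n]}) := forall w, in_first k w -> p@_w = q@_w.

Lemma eq_firstM k p q r : eq_first k p q -> eq_first k (r * p) (r * q).
Proof.
move=> eq_pq w w_k; rewrite !mcoeffM; apply: eq_bigr => ab /eqP def_w.
congr (_ * _); apply: eq_pq => i le_ki.
have /mnmP/(_ i) := def_w; rewrite w_k // mnmDE => /esym/eqP.
by rewrite addn_eq0 => /andP[_ /eqP].
Qed.

Definition subspace W :=
  [/\ W 0, forall p q, W p -> W q -> W (p + q) & forall c p, W p -> W (c *: p)].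

Definition mod_first k W p := exists2 q, W q & eq_first k q p.

Lemma mod_first_subspace k W : subspace W -> subspace (mod_first k W).
Proof.
case=> W0 WD WZ; split=> [|p q [p' Wp eq_p] [q' Wq eq_q]|c p [p' Wp eq_p]].
- by exists 0.
- by exists (p' + q') => [|w w_k]; [apply: WD | rewrite !mcoeffD eq_p ?eq_q].
by exists (c *: p') => [|w w_k]; [apply: WZ | rewrite !mcoeffZ eq_p].
Qed.

Lemma subspace_sum (I : Type) (rr : seq I) W (c : I -> K) (F : I -> {mpoly K[n]}) :
  subspace W -> (forall i, c i != 0 -> W (F i)) -> W (\sum_(i <- rr) c i *: F i).
Proof.
case=> W0 WD WZ WF; elim: rr => [|i rr IHr]; first by rewrite big_nil.
rewrite big_cons; case: (eqVneq (c i) 0) => [->|nz]; first by rewrite scale0r add0r.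
by apply: WD => //; apply/WZ/WF.
Qed.

Lemma mod_first_eq k W p q : eq_first k p q -> mod_first k W p -> mod_first k W q.
Proof. by move=> eq_pq [r Wr eq_r]; exists r => // w w_k; rewrite eq_r ?eq_pq. Qed.

Lemma span_variable k (A : {set 'I_n}) (i : 'I_n) : (k <= #|A|)%N ->
  exists2 l : 'I_n -> K, (forall j, j \notin A -> l j = 0) &
    eq_first k (\sum_j l j *: lin_change g 'X_j) 'X_i.
Proof.
move=> le_kA.
have [l l0 def_l] := generic_span g_generic A (fun a => (i == a)%:R).
exists l => // w w_k.
under eq_bigr => j _ do rewrite lin_changeX scaler_sumr.
rewrite exchange_big raddf_sum /=.
under eq_bigr => a _.
  under eq_bigr => j _ do rewrite scalerA.
  rewrite -scaler_suml mcoeffZ mcoeffX.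
over.
have big_first a :
    (\sum_j l j * g a j) * (U_(a)%MM == w)%:R = (i == a)%:R * (U_(a)%MM == w)%:R.
  case: eqP => [def_w|]; last by rewrite !mulr0.
  rewrite def_l // (leq_trans _ le_kA) // ltnNge; apply/negP=> /w_k.
  by rewrite -def_w mnm1E eqxx.
rewrite (eq_bigr _ (fun a _ => big_first a)) (bigD1 i) //= eqxx mul1r big1 ?addr0.
  by rewrite mcoeffX.
by move=> a ne_ai; rewrite eq_sym (negPf ne_ai) mul0r.
Qed.

Definition image_mon t : {mpoly K[n]} := lin_change g 'X_[mon n t].

Lemma image_mon_cons (j : 'I_n) t :
  image_mon (j.+1 :: t) = image_mon t * lin_change g 'X_j.
Proof.
by rewrite /image_mon mon_cons mon1 addmC mpolyXD lin_changeM.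
Qed.

Lemma image_mon_perm s t : perm_eq s t -> image_mon s = image_mon t.
Proof. by rewrite /image_mon => /perm_mon->. Qed.

(** Write P_t for the product of the forms l_c over c in the spread of t.
    Modulo the variables after x_m, the variable x_i is a combination of the
    forms l_c with c at most m + 2 |t| outside the pairs of t, as there are at
    least m of them.  So it suffices to treat P_t l_c.  If c lies after all the
    pairs, then P_t l_c is the product of a list below (s, m).  Otherwise c lies
    just before a pair of index p; exchanging c with t_p + 2p turns P_t l_c into
    P_t' l_c' with t' smaller than t, which the induction on the sum of the list
    covers. *)
Lemma exchange_space s m W : (0 < m)%N -> sorted leq (rcons s m) ->
  {in rcons s m, forall c, (c + 2 * (size s).+1 <= n + 2)%N} -> subspace W ->
  (forall t, below (rcons s m) t -> W (image_mon (spread t))) ->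
  forall t, below s t -> forall i, mod_first m W (image_mon (spread t) * 'X_i).
Proof.
move=> m_gt0 s_sorted s_n W_sub W_mon t.
have Wm_sub := mod_first_subspace m W_sub.
have [k] := ubnP (sumn t); elim: k t => // k IHk t lt_k t_s i.
have [sz_t t_sorted t_le] := t_s.
have m_n: (m + 2 * size t <= n)%N.
  by have := s_n m; rewrite mem_rcons inE eqxx sz_t => /(_ isT); lia.
pose A : {set 'I_n} := [set j : 'I_n | (j < m + 2 * size t)%N && (j.+1 \notin pairs t)].
have le_mA: (m <= #|A|)%N.
  have: (m + 2 * size t <= #|A :|: vertex_set n (pairs t)|)%N.
    have inj_w: injective (widen_ord m_n) by move=> a b [/val_inj].
    rewrite -[X in (X <= _)%N]card_ord -(card_imset _ inj_w).
    apply/subset_leq_card/subsetP=> _ /imsetP[j _ ->].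
    by rewrite !inE /=; case: (_ \in pairs t); rewrite ?orbT ?andbT ?orbF ?ltn_ord.
  have [+ _] := leq_card_setU A (vertex_set n (pairs t)).
  have: (#|vertex_set n (pairs t)| <= 2 * size t)%N.
    by rewrite -size_pairs card_vertex_set_leq.
  by lia.
have [l l0 eq_l] := span_variable i le_mA.
apply: mod_first_eq (eq_firstM (image_mon (spread t)) eq_l) _.
rewrite mulr_sumr; under eq_bigr => j _ do rewrite -scalerAr.
apply: subspace_sum => // j nz_j.
have Aj: j \in A by apply: contraNT nz_j => /l0->.
rewrite -image_mon_cons; move: Aj; rewrite inE => /andP[lt_j pairs_j].
have t_gt0 r : (r < size t)%N -> (0 < nth 0%N t r)%N by move=> /t_le/andP[].
have [p [b [le_p b_gt0 def_j lt_b le_b]]] := pairs_gap t_sorted t_gt0 (ltn0Sn j) pairs_j.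
have [lt_p|ge_p] := ltnP p (size t); last first.
  have eq_p: p = size t by apply/eqP; rewrite eqn_leq le_p.
  rewrite eq_p in def_j le_b; exists (image_mon (spread (rcons t b))).
    by apply/W_mon/below_rcons => //; lia.
  move=> w _; congr (_@_w); apply: image_mon_perm.
  by rewrite spread_rcons -def_j perm_rcons.
have t'_s: below s (set_nth 0%N t p b) by apply: below_set_nth => //; rewrite b_gt0 lt_b.
have lt_t' := sumn_set_nth_lt lt_p (lt_b lt_p).
have := perm_trans _ (spread_set_nth b lt_p).
rewrite -def_j => /(_ _ (perm_refl _))/image_mon_perm->.
have spread_n: (nth 0 t p + 2 * p <= n)%N.
  have: (nth 0 t p <= m)%N.
    have /andP[_ le_t] := t_le p lt_p; apply: leq_trans le_t _.
    have := sorted_nth (s := rcons s m) (p := p) (q := size s) s_sorted.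
    by rewrite size_rcons ltnS leqnn !nth_rcons ltnn eqxx -sz_t lt_p => ->//; apply: ltnW.
  by lia.
have vtx_p: (0 < nth 0%N t p + 2 * p <= n)%N by rewrite spread_n addn_gt0 t_gt0.
have [j' def_j'] := vertex_ord vtx_p.
rewrite def_j' image_mon_cons lin_changeX mulr_sumr.
under eq_bigr => i' _ do rewrite -scalerAr.
by apply: subspace_sum => // i' _; apply: IHk => //; apply: leq_trans lt_t' lt_k.
Qed.

Lemma image_mon_homog t : on_vertices n t -> image_mon t \is (size t).-homog.
Proof. by move=> t_n; rewrite -(mdeg_mon t_n); apply: lin_change_homog. Qed.

(** Induction on the degree.  The polynomials p of degree one less for which
    x_m p is congruent, modulo the variables after x_m, to an element of W form a
    space to which the induction hypothesis applies, by [exchange_space].  A form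
    f found there gives q in W that is congruent to x_m f; the initial monomial
    of x_m f is the wanted one, and the terms of q with a variable after x_m are
    smaller. *)
Lemma initial_of_spreads s W : sorted leq s -> on_vertices n s ->
  {in s, forall c, (c + 2 * size s <= n + 2)%N} -> subspace W ->
  (forall p, W p -> p \is (size s).-homog) ->
  (forall t, below s t -> W (image_mon (spread t))) ->
  exists2 f, W f & is_initial f (mon n s).
Proof.
elim/last_ind: s W => [|s m IHs] W s_sorted s_vtx s_n W_sub W_homog W_mon.
  have := W_mon [::] (And3 erefl isT (fun p => _)).
  rewrite /image_mon mon_nil mpolyX0 /lin_change comp_mpoly1 => W1.
  exists 1; first exact: W1.
  by split=> [|v]; rewrite msupp1 inE // => /eqP->; rewrite eqxx.
have m_vtx: (0 < m <= n)%N by apply: (allP s_vtx); rewrite mem_rcons inE eqxx.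
have [i def_m] := vertex_ord m_vtx; have m_gt0: (0 < m)%N by rewrite def_m.
have le_m c : c \in rcons s m -> (c <= m)%N.
  move=> s_c; have lt_c: (index c (rcons s m) < size (rcons s m))%N by rewrite index_mem.
  have := sorted_nth (q := size s) s_sorted _ _.
  rewrite nth_rcons ltnn eqxx size_rcons => /(_ (index c (rcons s m))).
  by rewrite nth_index //; apply; rewrite // -ltnS -(size_rcons s m).
have s'_vtx: on_vertices n s.
  by apply/allP=> c s_c; apply: (allP s_vtx); rewrite mem_rcons inE s_c orbT.
have s'_n: {in s, forall c, (c + 2 * size s <= n + 2)%N}.
  move=> c s_c; have := s_n c; rewrite mem_rcons inE s_c orbT size_rcons.
  by move=> /(_ isT); lia.
have [|||||t t_s|f [f_homog [q Wq eq_q]] init_f] := IHs (fun p =>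
  p \is (size s).-homog /\ mod_first m W (p * 'X_i)).
- exact: (subseq_sorted leq_trans (subseq_rcons s m)).
- exact: s'_vtx.
- exact: s'_n.
- have [M0 MD MZ] := mod_first_subspace m W_sub.
  split=> [|p1 p2 [hom1 M1] [hom2 M2]|c p [hom_p Mp]].
  + by rewrite mul0r; split; [apply: dhomog0 | apply: M0].
  + by rewrite mulrDl; split; [apply: dhomogD | apply: MD].
  by rewrite -scalerAl; split; [apply: dhomogZ | apply: MZ].
- by move=> p [].
- split; last first.
    by apply: (exchange_space m_gt0 s_sorted _ W_sub W_mon t_s); rewrite -(size_rcons s m).
  case: (t_s) => <- _ _; rewrite -size_spread; apply: image_mon_homog.
  exact: below_on_vertices s'_n t_s.
exists q => //; have init_X := is_initialMX U_(i)%MM init_f.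
rewrite mon_rcons def_m mon1.
have u_m: in_first m (mon n s + U_(i))%MM.
  rewrite -(mon1 i) -def_m -mon_rcons; apply/in_firstP.
  by rewrite monK.
have /is_initialP[nz_u lt_u] := init_X.
apply/is_initialP; split=> [|v ne_v nlt_v]; first by rewrite eq_q.
have [v_m|v_m] := classic (in_first m v); first by rewrite eq_q // lt_u.
apply: (dhomog_nemf_coeff (W_homog _ Wq)); apply: contraNneq nlt_v => /= deg_v.
apply: drl_lt_first u_m v_m; rewrite deg_v size_rcons.
by rewrite mdegD mdeg1 mdeg_mon // addn1.
Qed.

End KeyLemma.

(** * Initial monomials of the transformed ideal of the ball *)

(** Finitely many monomials precede a given one, since degree comes first. *)
Lemma drl_ind n (P : 'X_{1..n} -> Prop) :
  (forall v, (forall b, drl_lt b v -> P b) -> P v) -> forall v, P v.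
Proof.
move=> IH v; pose E := (mdeg v).+1.
have: (mdeg v < E)%N by [].
have [k] := ubnP #|[set w : 'X_{1..n < E} | drl_lt (bmnm w) v]|.
move: E => E; elim: k => // k IHk in v *; rewrite ltnS => lt_k deg_v.
apply: IH => b lt_b; have deg_b := leq_ltn_trans (drl_lt_mdeg lt_b) deg_v.
apply: IHk => //; apply: leq_trans lt_k; apply: proper_card; apply/properP; split.
  by apply/subsetP=> w; rewrite !inE => lt_w; apply: drl_lt_trans lt_b.
by exists (BMultinom deg_b); rewrite !inE // drl_ltnn.
Qed.

Lemma meval_lin_change (K : fieldType) n (g : 'M[K]_n) q y :
  (lin_change g q).@[y] = q.@[fun j => \sum_i y i * g i j].
Proof.
rewrite /lin_change comp_mpoly_meval; apply: meval_eq => j.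
rewrite tnth_mktuple raddf_sum /=; apply: eq_bigr => i _.
by rewrite mevalZ mevalXU mulrC.
Qed.

Section Ball.
Variables (K : fieldType) (n d : nat).
Hypothesis lt_dn : (d < n)%N.
Local Notation m := (n - d - 1)%N.
Variable U : 'X_{1..n} -> Prop.
Hypothesis U_shifted : shifted_order_ideal m U.
Hypothesis U_degree : degree_at_most (d %/ 2) U.
Variable g : 'M[K]_n.
Hypotheses (g_generic : generic g) (g_unit : g \in unitmx).
Implicit Types u v w b : 'X_{1..n}.

Definition nonface (C : {set 'I_n} -> Prop) b := ~ C (vertices b).

Lemma vertices_mono u v : (u <= v)%MM -> vertices u \subset vertices v.
Proof.
move/mnm_lepP=> le_uv; apply/subsetP=> i; rewrite !inE => /leq_trans; exact.
Qed.

Lemma nonface_up C u v : (forall F H : {set 'I_n}, C H -> F \subset H -> C F) ->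
  nonface C u -> (u <= v)%MM -> nonface C v.
Proof. by move=> C_down nCu /vertices_mono le_uv Cv; apply/nCu/(C_down _ _ Cv). Qed.

Lemma generated_down (D : {set 'I_n} -> Prop) (F H : {set 'I_n}) :
  generated_complex D H -> F \subset H -> generated_complex D F.
Proof. by move=> [G DG sHG] sFH; exists G => //; apply: subset_trans sHG. Qed.

Lemma vertices_mon s : vertices (mon n s) = vertex_set n s.
Proof. by apply/setP=> i; rewrite !inE mnmE -has_count has_pred1. Qed.

Local Notation N := (nonface (squeezed_ball d U)).

Lemma ball_nonface_up u v : N u -> (u <= v)%MM -> N v.
Proof. by apply: nonface_up; apply: generated_down. Qed.

(** In degree at most d/2 + 1 the spreads of all monomials concerned stay
    inside [n], so that [initial_of_spreads] applies to the forms of g(I_B). *)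
Lemma nonmember_initial_low v : in_first m v -> (mdeg v <= (d %/ 2).+1)%N -> ~ U v ->
  initial_monomial g N v.
Proof.
move=> v_m deg_v nUv.
pose k := size (indices v).
pose W (p : {mpoly K[n]}) :=
  p \is k.-homog /\ exists2 q, monomial_ideal N q & p = lin_change g q.
have s_n : {in indices v, forall c, (c + 2 * size (indices v) <= n + 2)%N}.
  move=> c v_c; have/in_firstP := v_m; rewrite size_indices => /(_ c v_c); lia.
have [||||p []|t t_s|f [_ [q Nq ->]]] := @initial_of_spreads K n g g_generic (indices v) W.
- exact: indices_sorted.
- exact: indices_on_vertices.
- exact: s_n.
- split.
  + split; [exact: dhomog0 | exists 0; first by move=> b; rewrite msupp0].
    by rewrite /lin_change comp_mpoly0.
  + move=> p1 p2 [hom1 [q1 N1 def_1]] [hom2 [q2 N2 def_2]]; split; first exact: dhomogD.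
    rewrite def_1 def_2; exists (q1 + q2); last by rewrite lin_changeD.
    by move=> b /msuppD_le; rewrite mem_cat => /orP[/N1|/N2].
  move=> c p [hom_p [q Nq def_p]]; split; first exact: dhomogZ.
  by rewrite def_p; exists (c *: q); [move=> b /msuppZ_le/Nq | rewrite lin_changeZ].
- by [].
- have t_n := below_on_vertices s_n t_s; case: (t_s) => sz_t t_sorted t_le.
  split; first by rewrite /k -sz_t -size_spread; apply: image_mon_homog.
  exists 'X_[mon n (spread t)]; last by [].
  move=> b; rewrite msuppX inE => /eqP->; rewrite /nonface vertices_mon.
  have t_vtx : on_vertices n t.
    apply/allP=> c /(nthP 0%N)[p lt_p <-].
    have /andP[-> le_t] := t_le p lt_p; apply: leq_trans le_t _.
    rewrite sz_t in lt_p.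
    by case/andP: (allP (indices_on_vertices v) _ (mem_nth 0%N lt_p)).
  have tK := monK t_sorted t_vtx; rewrite -{1}tK.
  apply: (spread_nonface lt_dn U_shifted) => //; rewrite ?tK //.
    apply/in_firstP; rewrite tK => c /(nthP 0%N)[p lt_p <-].
    have /andP[_ le_t] := t_le p lt_p; apply: leq_trans le_t _.
    by apply: in_first_nth v_m _; rewrite -sz_t.
  case: (U_shifted) => _ _ _ U_prec Ut; apply/nUv/(U_prec _ _ Ut v_m).
  by apply: mon_preceq_nth; rewrite tK // => p; rewrite -sz_t => /t_le/andP[].
by rewrite indicesK; exists q.
Qed.

(** A monomial of degree above d/2 + 1 has a divisor of degree d/2 + 1, which
    is outside U because of its degree. *)
Lemma nonmember_initial v : in_first m v -> ~ U v -> initial_monomial g N v.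
Proof.
move=> v_m nUv; have [deg_v|deg_v] := leqP (mdeg v) (d %/ 2).+1.
  exact: nonmember_initial_low.
pose w := mon n (take (d %/ 2).+1 (indices v)).
have le_wv: (w <= v)%MM by apply: mon_take.
apply: (@initial_monomial_up _ _ _ _ w) => //; first exact: ball_nonface_up.
have deg_w: mdeg w = (d %/ 2).+1.
  rewrite mdeg_mon ?size_takel ?size_indices ?(ltnW deg_v) //.
  exact/on_vertices_take/indices_on_vertices.
apply: nonmember_initial_low; rewrite ?deg_w //; last by move/U_degree; rewrite deg_w ltnn.
move=> i le_i; have /mnm_lepP/(_ i) := le_wv.
by rewrite v_m // leqn0 => /eqP.
Qed.

Lemma m_lt_n : (m < n)%N. Proof. lia. Qed.
Let im := Ordinal m_lt_n.

(** The n - d - 1 coordinates x_1, ..., x_m are determined by requiring that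
    the images vanish at the n - d - 1 vertices outside the facet.  If a further
    image vanished, a nonzero vector supported on the first m + 1 coordinates
    would annihilate m + 1 columns, against genericity. *)
Lemma facet_point u : U u -> exists y : 'I_n -> K,
  [/\ y im = 1, forall i : 'I_n, (m < i)%N -> y i = 0 &
      forall j, (\sum_i y i * g i j != 0) = (j \in Fd d u)].
Proof.
move=> Uu; pose A := ~: Fd d u.
have card_A: #|A| = m.
  have u_m := member_in_first U_shifted Uu; have deg_u := member_degree U_degree Uu.
  by have := cardsC (Fd d u); rewrite card_Fd // card_ord -/A; lia.
have [y0 y0_0 y0_A] := generic_solve g_generic A (fun j => - g im j).
pose y i := y0 i + (i == im)%:R.
have y_im: y im = 1 by rewrite /y y0_0 ?card_A ?add0r ?eqxx.
have y_0 (i : 'I_n) : (m < i)%N -> y i = 0.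
  move=> lt_i; rewrite /y y0_0 ?card_A ?(ltnW lt_i) // add0r.
  by case: eqP => // def_i; rewrite def_i /= ltnn in lt_i.
have y_A j : j \notin Fd d u -> \sum_i y i * g i j = 0.
  move=> F'j; under eq_bigr => i _ do rewrite mulrDl.
  rewrite big_split /= y0_A; last by rewrite in_setC.
  rewrite [X in _ + X](bigD1 im) //= eqxx mul1r.
  rewrite [X in _ + (_ + X)]big1 ?addr0 ?addNr // => i /negPf->; exact: mul0r.
exists y; split=> // j; have [Fj|/y_A->] := boolP (j \in _); last by rewrite eqxx.
apply/eqP=> y_j; have card_jA: #|j |: A| = m.+1 by rewrite cardsU1 card_A inE Fj.
have := generic_annihilator g_generic (A := j |: A) (y := y) _ _ im.
rewrite y_im card_jA => /(_ _ _)/eqP; rewrite oner_eq0 => /(_ y_0) absurd.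
suff: false by []; apply: absurd => i; rewrite in_setU1 in_setC => /predU1P[->|] //.
exact: y_A.
Qed.

(** With u0 both in U and initial there are fewer monomials in U other than u0
    than points y_w, so some nonzero functional L, a combination of evaluations
    at the points, kills them.  It kills all of g(I_B).  By induction along the
    monomial order it kills every monomial: an initial one is congruent modulo
    g(I_B) to a combination of smaller ones, one that uses a variable after
    x_(m+1) vanishes at the points, and one that uses x_(m+1) has there the
    values of a monomial of smaller degree.  But the image of the product of the
    variables of F_d(w) is nonzero at y_w only. *)
Lemma member_not_initial u0 : U u0 -> ~ initial_monomial g N u0.
Proof.
move=> Uu0 init_u0; pose T : finType := 'X_{1..n < (d %/ 2).+1}.
have decU (w : T) : exists b : bool, b <-> U (bmnm w).
  by case: (classic (U (bmnm w))) => [Uw|nUw]; [exists true | exists false].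
have [inU inUP] := fin_all_exists decU.
have pointT (w : T) : exists y : 'I_n -> K, inU w ->
    [/\ y im = 1, forall i : 'I_n, (m < i)%N -> y i = 0 &
        forall j, (\sum_i y i * g i j != 0) = (j \in Fd d (bmnm w))].
  have [Uw|nUw] := boolP (inU w); last by exists (fun=> 0).
  by have [y yP] := facet_point (proj1 (inUP w) Uw); exists y.
have [y yP] := fin_all_exists pointT.
have inT v : U v -> exists2 w : T, inU w & v = bmnm w.
  move=> Uv; have lt_v: (mdeg v < (d %/ 2).+1)%N by rewrite ltnS U_degree.
  by exists (BMultinom lt_v); rewrite ?inUP.
have [w0 Uw0 def_u0] := inT _ Uu0.
have [c nz_c c_ker] : exists2 c : T -> K, exists w : T, inU w && (c w != 0) &
    forall w : T, inU w -> w != w0 ->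
      \sum_(x : T | inU x) c x * 'X_[bmnm w].@[y x] = 0.
  (* The column of w0 is zero, so A is singular; the rows outside U are unit
     vectors, which forces a left kernel vector to be supported on U. *)
  pose A := \matrix_(a, b < #|T|)
    let x := enum_val a : T in let w := enum_val b : T in
    if inU x then (if inU w && (w != w0) then 'X_[bmnm w].@[y x] else 0) else (x == w)%:R.
  have detA: \det A == 0.
    rewrite (expand_det_col _ (enum_rank w0)) big1 // => a _.
    rewrite mxE /= enum_rankK Uw0 eqxx /=.
    case: ifP => [_|/negP nUx]; first by rewrite mul0r.
    case: eqP => [eq_x|_]; last by rewrite mul0r.
    by rewrite eq_x in nUx.
  have [c nz_c cA] := det0P detA; pose cT (x : T) := c 0 (enum_rank x).
  have sumA (w : T) : \sum_(x : T) cT x * A (enum_rank x) (enum_rank w) = 0.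
    have /rowP/(_ (enum_rank w)) := cA; rewrite !mxE => def_0.
    by rewrite -[RHS]def_0 [RHS](reindex _ (onW_bij _ (enum_rank_bij T))).
  have c_out (w : T) : ~~ inU w -> cT w = 0.
    move=> nUw; have := sumA w; rewrite (bigD1 w) //= big1 => [|x ne_x].
      by rewrite mxE /= !enum_rankK (negPf nUw) eqxx mulr1 addr0.
    rewrite mxE /= !enum_rankK (negPf nUw) /= (negPf ne_x).
    by case: ifP => _; rewrite mulr0.
  exists cT.
    have /rV0Pn[a nz_a] := nz_c; exists (enum_val a).
    have nz : cT (enum_val a) != 0 by rewrite /cT enum_valK.
    by rewrite nz andbT; apply: contraNT nz => /c_out->.
  move=> w Uw ne_w; rewrite -[RHS](sumA w) [RHS](bigID inU) /= [X in _ = _ + X]big1 ?addr0.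
    by apply: eq_bigr => x Ux; rewrite mxE /= !enum_rankK Ux Uw ne_w.
  by move=> x /c_out->; rewrite mul0r.
pose L p := \sum_(x : T | inU x) c x * p.@[y x].
have L_sum p : L p = \sum_(b <- msupp p) p@_b * L 'X_[b].
  under [RHS]eq_bigr => b _ do rewrite /L mulr_sumr.
  rewrite exchange_big; apply: eq_bigr => x _; rewrite mevalE mulr_sumr.
  by apply: eq_bigr => b _; rewrite mevalX mulrCA.
have L_ideal q : monomial_ideal N q -> L (lin_change g q) = 0.
  move=> Nq; apply: big1 => x Ux; rewrite meval_lin_change mevalE big_seq.
  rewrite big1 ?mulr0 // => b /Nq Nb; have [_ _ supp_y] := yP x Ux.
  suff /subsetPn[j b_j F'j]: ~~ (vertices b \subset Fd d (bmnm x)).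
    rewrite (bigD1 j) //=; have := supp_y j; rewrite (negPf F'j) => /negbFE/eqP->.
    rewrite inE in b_j; by rewrite expr0n -[b j == 0%N]negbK -lt0n b_j mul0r mulr0.
  apply/negP=> sub; apply: Nb; exists (Fd d (bmnm x)) => //.
  by exists (bmnm x); rewrite // -inUP.
have L_mon v : L 'X_[v] = 0.
  elim/drl_ind: v => v IHv.
  have step : initial_monomial g N v -> L 'X_[v] = 0.
    case=> q Nq init_v; have [p_v lt_v] := init_v.
    have := L_ideal q Nq; rewrite L_sum (bigD1_seq v) ?msupp_uniq //= big_seq_cond.
    rewrite big1 ?addr0 => [|b /andP[p_b ne_b]]; last first.
      by rewrite IHv ?mulr0 // lt_v.
    by move/eqP; rewrite mulf_eq0 -[_ == 0]negbK -mcoeff_msupp p_v => /eqP.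
  have [v_m|nv_m] := classic (in_first m v).
    have [Uv|nUv] := classic (U v); last exact/step/nonmember_initial.
    have [def_v|ne_v] := eqVneq v u0; first by apply: step; rewrite def_v.
    have [w Uw def_v] := inT v Uv; rewrite def_v; apply: c_ker => //.
    by apply: contraNneq ne_v => eq_w; rewrite def_v eq_w def_u0.
  (* Dropping x_(m+1), which equals 1 at all the points, lowers the degree. *)
  pose v' : 'X_{1..n} := [multinom if (i < m)%N then v i else 0%N | i < n].
  have le_v' i : (v' i <= v i)%N by rewrite mnmE; case: ifP.
  have [v_0|] := classic (forall i : 'I_n, (m < i)%N -> v i = 0%N); last first.
    move=> nv_0; have [i nv_i] := not_all_ex_not _ _ nv_0.
    have [lt_i /eqP v_i] := imply_to_and _ _ nv_i.
    apply: big1 => x Ux; rewrite mevalX (bigD1 i) //=; have [_ y0 _] := yP x Ux.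
    by rewrite y0 // expr0n (negPf v_i) mul0r mulr0.
  have -> : L 'X_[v] = L 'X_[v'].
    apply: eq_bigr => x Ux; congr (_ * _); rewrite !mevalX; apply: eq_bigr => i _.
    rewrite mnmE; case: ltnP => // le_i; rewrite expr0.
    have [y1 _ _] := yP x Ux; have [eq_i|lt_i] := eqVneq (val i) m.
      by rewrite (_ : i = im) ?y1 ?expr1n //; apply: val_inj.
    by rewrite v_0 ?expr0 // ltn_neqAle eq_sym lt_i.
  apply: IHv; apply/drl_ltP; left; rewrite ltn_neqAle !mdegE.
  apply/andP; split; last exact: leq_sum.
  apply: contra_notN nv_m => /eqP eq_deg i le_i.
  have := leqif_sum (I := 'I_n) (P := predT) (fun i _ => leqif_eq (le_v' i)).
  case=> _; rewrite eq_deg eqxx => /esym/forallP/(_ i)/eqP <-.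
  by rewrite mnmE ltnNge le_i.
have [w /andP[Uw nz_w]] := nz_c.
have: L (lin_change g 'X_[indicator (Fd d (bmnm w))]) = 0.
  by rewrite L_sum big1 // => b _; rewrite L_mon mulr0.
rewrite /L (bigD1 w) //= big1 ?addr0 => [|x /andP[Ux ne_x]].
  rewrite meval_lin_change mevalX; apply/eqP; rewrite mulf_neq0 //.
  have [_ _ supp_y] := yP w Uw.
  apply/prodf_neq0 => j _; rewrite mnmE.
  by have [Fj|_] := boolP (j \in _); rewrite ?oner_neq0 // expr1 supp_y.
rewrite meval_lin_change mevalX; have [_ _ supp_y] := yP x Ux.
suff /subsetPn[j Fj F'j]: ~~ (Fd d (bmnm w) \subset Fd d (bmnm x)).
  rewrite (bigD1 j) //= mnmE Fj; have := supp_y j.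
  by rewrite (negPf F'j) => /negbFE/eqP->; rewrite expr1 mul0r mulr0.
apply: contra ne_x => sub; apply/eqP/val_inj.
by apply/esym/(Fd_inj lt_dn U_shifted U_degree) => //; apply/inUP.
Qed.
End Ball.

(** * Existence of the generic initial ideal *)

Section Pivots.
Variables (K : fieldType) (r N : nat).
Implicit Types A : 'M[K]_(r, N).

Definition prefix_rank A k := \rank (A *m (pid_mx k : 'M_N)).

Definition pivot A (j : 'I_N) := (prefix_rank A j < prefix_rank A j.+1)%N.

Lemma mul_pid_mxE s (M : 'M[K]_(s, N)) k a (i : 'I_N) :
  (M *m (pid_mx k : 'M_N)) a i = M a i *+ (i < k)%N.
Proof.
rewrite !mxE (bigD1 i) //= big1 ?addr0 => [|l ne_li]; last first.
  by rewrite mxE (inj_eq val_inj) (negPf ne_li) mulr0.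
by rewrite mxE eqxx /= mulr_natr.
Qed.

Lemma pid_mx_cut k l : (k <= l)%N ->
  (pid_mx l : 'M[K]_N) *m (pid_mx k : 'M_N) = pid_mx k.
Proof.
move=> le_kl; apply/matrixP=> i j; rewrite mul_pid_mxE !mxE.
case: eqP => [->|_] /=; last by rewrite mul0rn.
by have [lt_j|_] := ltnP j k; rewrite ?mulr0n // (leq_trans lt_j).
Qed.

(** Column j is a pivot when some combination of the rows starts in column j:
    the left kernel shrinks exactly when a column raises the rank. *)
Lemma pivotP A j : reflect
  (exists2 a : 'rV_r, (a *m A) 0 j != 0 & forall i : 'I_N, (i < j)%N -> (a *m A) 0 i = 0)
  (pivot A j).
Proof.
set B := A *m (pid_mx j : 'M_N); set C := A *m (pid_mx j.+1 : 'M_N).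
have defB: B = C *m (pid_mx j : 'M_N) by rewrite -mulmxA pid_mx_cut.
have kerCB: (kermx C <= kermx B)%MS.
  by apply/sub_kermxP; rewrite defB mulmxA mulmx_ker mul0mx.
have BP (a : 'rV_r) : a *m B = 0 <-> forall i : 'I_N, (i < j)%N -> (a *m A) 0 i = 0.
  split=> [/rowP aB i lt_i|a0]; last apply/rowP=> i.
    by have := aB i; rewrite mulmxA mul_pid_mxE lt_i [RHS]mxE.
  by rewrite mulmxA mul_pid_mxE [RHS]mxE; case: ltnP => // /a0->.
apply: (iffP idP) => [lt_BC|[a nz_a a0]].
  (* A row of the kernel of B outside that of C is the required combination. *)
  have /row_subPn[i]: ~~ (kermx B <= kermx C)%MS.
    apply: contraTN lt_BC => /mxrankS; rewrite !mxrank_ker -leqNgt.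
    have := rank_leq_row B; have := rank_leq_row C.
    by rewrite /prefix_rank -/B -/C; lia.
  set a := row i _ => nker_a.
  have /BP aA: a *m B = 0 by rewrite /a -row_mul mulmx_ker row0.
  exists a => //; apply: contraNneq nker_a => a_j.
  apply/sub_kermxP/rowP=> l; rewrite mulmxA mul_pid_mxE [RHS]mxE ltnS leq_eqVlt.
  by case: eqP => [/val_inj->|_] /=; [rewrite a_j mul0rn | case: ltnP => // /aA->].
rewrite /pivot ltnNge; apply/negP=> le_CB.
have := mxrank_leqif_sup kerCB; case=> _; rewrite !mxrank_ker.
have -> : (r - \rank C == r - \rank B)%N.
  rewrite eqn_leq leq_sub2l /=; first exact: leq_sub2l.
  by rewrite defB mxrankM_maxl.
move/esym=> sub_ker.
have /rowP/(_ j): a *m C = 0.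
  by apply/sub_kermxP; apply: submx_trans sub_ker; apply/sub_kermxP/BP.
by rewrite mulmxA mul_pid_mxE ltnSn [RHS]mxE => /eqP; rewrite (negPf nz_a).
Qed.

Lemma prefix_rank_le A k : (prefix_rank A k <= r)%N.
Proof. exact: rank_leq_row. Qed.

Lemma prefix_rank_full A : prefix_rank A N = \rank A.
Proof. by rewrite /prefix_rank pid_mx_1 mulmx1. Qed.

Lemma rank_pivots A : \rank A = #|[set j | pivot A j]|.
Proof.
have step (j : 'I_N) : prefix_rank A j.+1 = (prefix_rank A j + pivot A j)%N.
  have le_j: (prefix_rank A j <= prefix_rank A j.+1)%N.
    by rewrite /prefix_rank -(pid_mx_cut (leqnSn j)) mulmxA mxrankM_maxl.
  have: (prefix_rank A j.+1 <= (prefix_rank A j).+1)%N.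
    have -> : prefix_rank A j.+1 = \rank (A *m (pid_mx j : 'M_N) + A *m delta_mx j j)%R.
      rewrite -mulmxDr; congr (\rank (_ *m _)); apply/matrixP=> i l; rewrite !mxE.
      rewrite -!(inj_eq val_inj) /= ltnS leq_eqVlt.
      have [<-|ne_il] := eqVneq (i : nat) (l : nat) => /=.
        by case: ltngtP; rewrite ?addr0 ?add0r.
      have [<-|_] := eqVneq (i : nat) (j : nat); last by rewrite addr0.
      by rewrite eq_sym (negPf ne_il) addr0.
    apply: leq_trans (mxrank_add _ _) _; rewrite -addn1 leq_add2l.
    by apply: leq_trans (mxrankM_maxr _ _) _; rewrite mxrank_delta.
  by rewrite /pivot; case: ltngtP le_j => // lt_j _; lia.
have sum_k k : (k <= N)%N -> prefix_rank A k = (\sum_(j < N | (j < k)%N) pivot A j)%N.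
  elim: k => [_|k IHk lt_k].
    by rewrite big_pred0 // /prefix_rank pid_mx_0 mulmx0 mxrank0.
  rewrite (step (Ordinal lt_k)) /= IHk ?(ltnW lt_k) // [RHS](bigD1 (Ordinal lt_k)) //= addnC.
  congr (_ + _)%N; apply: eq_bigl => j; rewrite -(inj_eq val_inj) /=.
  by rewrite ltnS andbC -ltn_neqAle.
rewrite -prefix_rank_full sum_k //.
rewrite -sum1dep_card big_mkcond [RHS]big_mkcond; apply: eq_bigr => j _.
by rewrite ltn_ord; case: (pivot A j).
Qed.

End Pivots.

Section Dickson.
Variable n : nat.
Implicit Types u v w : 'X_{1..n}.

Lemma nat_bound (T : finType) (P : T -> nat -> Prop) :
  (forall x a b, (a <= b)%N -> P x a -> P x b) -> (forall x, exists b, P x b) ->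
  exists b, forall x, P x b.
Proof.
move=> P_up ex; have [b Pb] := fin_all_exists ex.
exists (\max_x b x) => x; exact: P_up (leq_bigmax x) (Pb x).
Qed.

(** Dickson's lemma on a set s of coordinates, by induction on s.  For a new
    coordinate i, elements of P with large u_i are above one of finitely many
    representatives of the small patterns on s, and for each of the remaining
    values of u_i the induction hypothesis applies to a slice of P. *)
Lemma dickson_coordinates (s : seq 'I_n) (P : 'X_{1..n} -> Prop) :
  exists D, forall u, P u -> exists2 v, P v &
    {in s, forall i, v i <= u i /\ v i <= D}%N.
Proof.
elim: s => [|i s IHs] in P *; first by exists 0%N => u Pu; exists u.
have [D0 D0P] := IHs P.
have [a0 a0P]: exists a, forall c : {ffun 'I_n -> 'I_D0.+1},
    (exists2 v, P v & {in s, forall j, v j = c j :> nat}) ->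
    exists v, [/\ P v, {in s, forall j, v j = c j :> nat} & v i <= a]%N.
  apply: nat_bound => [c a b le_ab Pa ex_v|c].
    by have [v [Pv v_c le_v]] := Pa ex_v; exists v; split=> //; apply: leq_trans le_ab.
  have [[v Pv v_c]|no_v] := classic (exists2 v, P v & {in s, forall j, v j = c j :> nat}).
    by exists (v i) => _; exists v.
  by exists 0%N.
have [D1 D1P]: exists D, forall a : 'I_a0.+1, forall u, P u -> u i = a ->
    exists v, [/\ P v, v i = a & {in s, forall j, v j <= u j /\ v j <= D}%N].
  apply: nat_bound => [a b c le_bc Pb u Pu u_a|a].
    have [v [Pv v_a v_s]] := Pb u Pu u_a; exists v; split=> // j /v_s[le_u le_b].
    by split=> //; apply: leq_trans le_bc.
  have [D DP] := IHs (fun u => P u /\ u i = a); exists D => u Pu u_a.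
  by have [v [Pv v_a] v_s] := DP u (conj Pu u_a); exists v.
exists (maxn (maxn D0 a0) D1) => u Pu.
have [le_u|lt_u] := leqP (u i) a0.
  have [v [Pv v_i v_s]] := D1P (Ordinal (le_u : (u i < a0.+1)%N)) u Pu erefl.
  exists v => // j; rewrite inE => /predU1P[->|/v_s[]]; first by rewrite v_i /=; lia.
  by lia.
have [w Pw w_s] := D0P u Pu.
pose c := [ffun j => inord (w j) : 'I_D0.+1].
have w_c: {in s, forall j, w j = c j :> nat}.
  by move=> j /w_s[_ le_w]; rewrite ffunE inordK.
have [|v [Pv v_c le_v]] := a0P c; first by exists w.
exists v => // j; rewrite inE => /predU1P[->|s_j]; first by lia.
by rewrite v_c // -w_c //; have := w_s j s_j; lia.
Qed.

Lemma dickson (P : 'X_{1..n} -> Prop) :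
  exists D, forall u, P u -> exists v, [/\ P v, (v <= u)%MM & (mdeg v <= D)%N].
Proof.
have [D DP] := dickson_coordinates (enum 'I_n) P.
exists (n * D)%N => u /DP[v Pv v_u]; exists v; split=> //.
  by apply/mnm_lepP=> i; case: (v_u i); rewrite ?mem_enum.
rewrite mdegE -[n in (n * D)%N]card_ord -sum_nat_const; apply: leq_sum => i _.
by case: (v_u i); rewrite ?mem_enum.
Qed.

End Dickson.

Lemma generic_max_rank (K : fieldType) n (rk : 'M[K]_n -> nat -> nat) b :
  (forall s : seq K, exists x : K, x \notin s) ->
  (forall g k, rk g k <= b)%N ->
  (forall g0 k, exists2 F, polyfun F /\ F g0 != 0 &
     forall g, F g != 0 -> (rk g0 k <= rk g k)%N) ->
  exists2 F, generically_nz F & forall g, F g != 0 -> forall h k,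
    (k <= b)%N -> (rk h k <= rk g k)%N.
Proof.
move=> Kinfinite rk_b rk_semi.
have max_k (k : 'I_b.+1) : exists F, generically_nz F /\
    forall g, F g != 0 -> forall h, (rk h k <= rk g k)%N.
  have [||_ [g0 <-] g0_max] := @exists_max_nat (fun r => exists g, rk g k = r) b.
  - by exists (rk 0 k), 0.
  - by move=> _ [g <-].
  have [F [F_poly F_g0] F_rk] := rk_semi g0 k.
  exists F; split=> [|g nz_g h]; first by split=> //; exists g0.
  by apply: leq_trans (F_rk g nz_g); apply: g0_max; exists h.
have [F F_nz] := fin_all_exists max_k.
exists (fun g => \prod_k F k g).
  by apply: generically_nz_prod => // k; case: (F_nz k).
move=> g /prodf_neq0 nz h k le_k.
by have [_ ] := F_nz (Ordinal (le_k : (k < b.+1)%N)); apply; apply: nz.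
Qed.

Section GenericInitialIdeal.
Variables (K : fieldType) (n : nat).
Hypothesis Kinfinite : forall s : seq K, exists x : K, x \notin s.
Variable N : pred 'X_{1..n}.
Hypothesis N_up : forall u v, N u -> (u <= v)%MM -> N v.
Implicit Types (u v w b : 'X_{1..n}) (g : 'M[K]_n) (e : nat).

Local Notation init g u := (initial_monomial g (fun b => N b) u).

Definition drl_ge u v := (u == v) || drl_lt v u.

Definition monomials_le e : seq 'X_{1..n} :=
  sort drl_ge [seq bmnm w | w : 'X_{1..n < e.+1}].

Lemma mem_monomials_le e u : (u \in monomials_le e) = (mdeg u <= e)%N.
Proof.
rewrite mem_sort; apply/imageP/idP => [[w _ ->]|deg_u]; first by rewrite -ltnS bmdeg.
by exists (BMultinom (deg_u : (mdeg u < e.+1)%N)).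
Qed.

Lemma drl_ge_trans : transitive drl_ge.
Proof.
move=> v u w /orP[/eqP->//|lt_vu] /orP[/eqP<-|lt_wv]; apply/orP; right => //.
exact: drl_lt_trans lt_vu.
Qed.

Lemma nth_monomials_le e i j : (i < j < size (monomials_le e))%N ->
  drl_lt (nth 0%MM (monomials_le e) j) (nth 0%MM (monomials_le e) i).
Proof.
case/andP=> lt_ij lt_j; have lt_i := ltn_trans lt_ij lt_j.
have s_sorted: sorted drl_ge (monomials_le e).
  apply: sort_sorted => u v; rewrite /drl_ge; case: (eqVneq u v) => //= ne_uv.
  by case/orP: (drl_lt_total ne_uv) => ->; rewrite ?orbT.
have uniq_le: uniq (monomials_le e).
  by rewrite sort_uniq map_inj_uniq ?enum_uniq //; apply: val_inj.
have := sorted_ltn_nth drl_ge_trans 0%MM s_sorted i j lt_i lt_j lt_ij.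
by rewrite /drl_ge nth_uniq // (ltn_eqF lt_ij).
Qed.

Lemma monomials_le_sorted e : exists2 s : seq 'X_{1..n},
  forall u, (u \in s) = (mdeg u <= e)%N &
  forall i j, (i < j < size s)%N -> drl_lt (nth 0%MM s j) (nth 0%MM s i).
Proof.
exists (monomials_le e); first exact: mem_monomials_le.
exact: nth_monomials_le.
Qed.

Section FixedDegree.
Variables (e : nat) (s : seq 'X_{1..n}).
Hypothesis mem_s : forall u, (u \in s) = (mdeg u <= e)%N.
Hypothesis sorted_s : forall i j, (i < j < size s)%N ->
  drl_lt (nth 0%MM s j) (nth 0%MM s i).

Lemma uniq_degree_list : uniq s.
Proof.
apply/(uniqP 0%MM) => i j; rewrite !inE => lt_i lt_j eq_ij.
case: (ltngtP i j) => // [lt_ij|lt_ji].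
  by have := @sorted_s i j; rewrite lt_ij lt_j eq_ij drl_ltnn => /(_ isT).
by have := @sorted_s j i; rewrite lt_ji lt_i eq_ij drl_ltnn => /(_ isT).
Qed.

(** Rows are the images of the monomials of the ideal, columns the monomials in
    decreasing order, so that pivots are initial monomials.  Rows outside the
    ideal are set to 0 to keep the matrix square. *)
Definition coef_matrix g : 'M[K]_(size s) :=
  \matrix_(i, j) if N (nth 0%MM s i)
    then (lin_change g 'X_[nth 0%MM s i])@_(nth 0%MM s j)
    else 0.

Lemma polyfun_coef_matrix i j : polyfun (fun g => coef_matrix g i j).
Proof.
case Ni: (N (nth 0%MM s i)).
  have [f Ff] := @polyfun_lin_change K n (nth 0%MM s i) (nth 0%MM s j).
  by exists f => g; rewrite mxE Ni Ff.
by have [f Ff] := @polyfun_const K n 0; exists f => g; rewrite mxE Ni -Ff.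
Qed.

Lemma sum_degree_list (F : 'X_{1..n} -> K) :
  \sum_(i < size s) F (nth 0%MM s i) = \sum_(b <- s) F b.
Proof. by rewrite [RHS](big_nth 0%MM) big_mkord. Qed.

(** A combination of the rows is the image of an element of the ideal, and its
    first nonzero column is the initial monomial of that image. *)
Lemma pivot_initial g (j : 'I_(size s)) :
  pivot (coef_matrix g) j <-> init g (nth 0%MM s j).
Proof.
set u := nth 0%MM s j.
have s_u: (mdeg u <= e)%N by rewrite -mem_s mem_nth.
split=> [/pivotP[a nz_a a0]|[q Nq init_u]].
  pose q := \sum_(i < size s) (if N (nth 0%MM s i) then a 0 i else 0) *: 'X_[nth 0%MM s i].
  have q_coef (l : 'I_(size s)) : (lin_change g q)@_(nth 0%MM s l) = (a *m coef_matrix g) 0 l.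
    rewrite mxE [lin_change _ _]linear_sum raddf_sum; apply: eq_bigr => i _ /=.
    rewrite comp_mpolyZ mcoeffZ !mxE; case: ifP => _; first by [].
    by rewrite mul0r mulr0.
  have q_deg v : (e < mdeg v)%N -> (lin_change g q)@_v = 0.
    move=> lt_v; rewrite [lin_change _ _]linear_sum raddf_sum big1 // => i _ /=.
    rewrite comp_mpolyZ mcoeffZ mcoeff_lin_change ?mulr0 //.
    rewrite neq_ltn orbC (leq_ltn_trans _ lt_v) // -mem_s; exact: mem_nth.
  exists q.
    move=> b; apply: contraLR => nNb; rewrite mcoeff_msupp negbK raddf_sum big1 // => i _ /=.
    rewrite mcoeffZ mcoeffX; case: eqP => [->|_]; last by rewrite mulr0.
    by rewrite (negPf nNb) mul0r.
  apply/is_initialP; split=> [|v ne_v nlt_v]; first by rewrite q_coef.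
  have [s_v|lt_v] := leqP (mdeg v) e; last exact: q_deg.
  have lt_l: (index v s < size s)%N by rewrite index_mem mem_s.
  have def_v: v = nth 0%MM s (Ordinal lt_l) by rewrite nth_index ?mem_s.
  rewrite def_v q_coef a0 // ltnNge leq_eqVlt; apply/negP=> /orP[/eqP/val_inj eq_j|lt_j].
    by rewrite def_v -eq_j eqxx in ne_v.
  by rewrite def_v sorted_s ?lt_j ?lt_l in nlt_v.
have coefE (l : 'I_(size s)) :
    (\row_i q@_(nth 0%MM s i) *m coef_matrix g) 0 l = (lin_change g q)@_(nth 0%MM s l).
  set w := nth 0%MM s l; have s_w: (mdeg w <= e)%N by rewrite -mem_s mem_nth.
  rewrite mxE (eq_bigr (fun i : 'I_(size s) =>
    q@_(nth 0%MM s i) * (lin_change g 'X_[nth 0%MM s i])@_w)).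
    rewrite (sum_degree_list (fun b => q@_b * (lin_change g 'X_[b])@_w)).
    rewrite lin_changeE raddf_sum /= (bigID (mem (msupp q))) /= addrC big1 ?add0r; last first.
      by move=> b /memN_msupp_eq0->; rewrite mul0r.
    rewrite [RHS](bigID (mem s)) /= [X in _ = _ + X]big1 ?addr0; last first.
      move=> b; rewrite mem_s -ltnNge => lt_b; rewrite mcoeffZ mcoeff_lin_change ?mulr0 //.
      by rewrite neq_ltn (leq_ltn_trans s_w).
    rewrite -big_filter -[RHS]big_filter.
    under [RHS]eq_bigr => b _ do rewrite mcoeffZ.
    apply/perm_big/uniq_perm; rewrite ?filter_uniq ?msupp_uniq ?uniq_degree_list // => b.
    by rewrite !mem_filter andbC.
  move=> i _; rewrite !mxE; case Ni: (N _) => //.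
  by rewrite mulr0 memN_msupp_eq0 ?mul0r //; apply: contraFN Ni => /Nq.
apply/pivotP; exists (\row_i q@_(nth 0%MM s i)).
  by rewrite coefE; have /is_initialP[] := init_u.
move=> i lt_i; rewrite coefE; have /is_initialP[_ -> //] := init_u.
  by rewrite /u nth_uniq ?uniq_degree_list // neq_ltn lt_i.
apply/negP=> lt_iu; have lt_ui: drl_lt u (nth 0%MM s i).
  by apply: sorted_s; rewrite lt_i ltn_ord.
by have := drl_lt_trans lt_iu lt_ui; rewrite drl_ltnn.
Qed.

Lemma pivot_monomial u : (mdeg u <= e)%N ->
  exists j, forall g, pivot (coef_matrix g) j <-> init g u.
Proof.
rewrite -mem_s => s_u.
have lt_u: (index u (s) < size s)%N by rewrite index_mem.
exists (Ordinal lt_u) => g; have := pivot_initial g (Ordinal lt_u).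
by rewrite nth_index.
Qed.

(** The pivots are determined by the ranks of the sets of leading columns, and
    these ranks are all maximal for generic g. *)
Lemma generic_initial_low : exists2 F : 'M[K]_n -> K, generically_nz F &
  (forall g h, F g != 0 -> F h != 0 -> forall u, (mdeg u <= e)%N -> init g u -> init h u) /\
  (forall g h, F g != 0 -> (\rank (coef_matrix h) <= \rank (coef_matrix g))%N).
Proof.
(* Abstracting the ranks keeps conversion away from Gaussian elimination. *)
have [rk [rk_pivot rk_full rk_gen]] : exists rk : 'M[K]_n -> nat -> nat,
   [/\ forall g (j : 'I_(size s)), pivot (coef_matrix g) j = (rk g j < rk g j.+1)%N,
       forall g, \rank (coef_matrix g) = rk g (size s) &
       exists2 F, generically_nz F & forall g, F g != 0 -> forall h k,
         (k <= size s)%N -> (rk h k <= rk g k)%N].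
  exists (fun g => prefix_rank (coef_matrix g)); split=> [//|g|].
    by rewrite prefix_rank_full.
  apply: (@generic_max_rank _ _ _ (size s) Kinfinite) => [g k|g0 k].
    exact: prefix_rank_le.
  apply: rank_generic; apply: polyfun_mulmx => i j; last exact: polyfun_const.
  exact: polyfun_coef_matrix.
have [F nzF F_rank] := rk_gen; exists F => //; split=> [g h nz_g nz_h u|g h nz_g].
  move=> /pivot_monomial[j pivot_u] /pivot_u piv_g; apply/pivot_u; move: piv_g.
  have eq_rank k : (k <= size s)%N -> rk g k = rk h k.
    by move=> le_k; apply/eqP; rewrite eqn_leq !F_rank.
  by rewrite !rk_pivot !eq_rank // ltnW.
by rewrite !rk_full F_rank.
Qed.

End FixedDegree.

Definition generically_initial u :=
  exists2 F : 'M[K]_n -> K, generically_nz F & forall g, F g != 0 -> init g u.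

Lemma generically_initialP e (F : 'M[K]_n -> K) : generically_nz F ->
  (forall g h, F g != 0 -> F h != 0 -> forall u, (mdeg u <= e)%N -> init g u -> init h u) ->
  forall g u, F g != 0 -> (mdeg u <= e)%N -> generically_initial u <-> init g u.
Proof.
move=> nzF F_init g u nz_g deg_u; split=> [[G nzG G_init]|init_u]; last first.
  by exists F => [|h nz_h]; [exact: nzF | exact: F_init nz_g nz_h u deg_u init_u].
have [_ [h]] := generically_nzM Kinfinite nzF nzG.
rewrite mulf_eq0 negb_or => /andP[nz_F nz_G].
exact: F_init (G_init h nz_G).
Qed.

(** By Dickson's lemma the generic initial monomials are generated in degrees
    at most some D.  If g is generic in degrees at most D, then all of them are
    initial for g.  No other monomial is: in each degree bound, the number of
    initial monomials of g is the rank of a matrix, which cannot exceed its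
    generic value. *)
Lemma generic_initial_set : exists2 F : 'M[K]_n -> K, generically_nz F &
  forall g, g \in unitmx -> F g != 0 -> forall u, init g u <-> generically_initial u.
Proof.
have [D DP] := dickson generically_initial.
have [sD memD sortedD] := monomials_le_sorted D.
have [F nzF [F_init _]] := generic_initial_low memD sortedD; exists F => // g g_unit nz_g u.
have gen_init v : generically_initial v -> init g v.
  move=> gen_v; have [w [gen_w le_wv deg_w]] := DP v gen_v.
  apply: initial_monomial_up le_wv => //.
  by apply/(generically_initialP nzF F_init).
split; last exact: gen_init.
set e := mdeg u => init_u.
have [s mem_s sorted_s] := monomials_le_sorted e.
have [G nzG [G_init G_rank]] := generic_initial_low mem_s sorted_s.
have [_ [h nz_h]] := nzG.
have genP := generically_initialP nzG G_init nz_h.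
apply/(genP u (leqnn _)).
pose piv g' := [set j | pivot (coef_matrix s g') j].
have pivP g' j : j \in piv g' <-> init g' (nth 0%MM s j).
  by rewrite in_set; apply: pivot_initial.
have sub: piv h \subset piv g.
  have deg_s (j : 'I_(size s)) : (mdeg (nth 0%MM s j) <= e)%N by rewrite -mem_s mem_nth.
  by apply/subsetP=> j /pivP init_j; apply/pivP/gen_init/(proj2 (genP _ (deg_s j))).
have eq_piv: piv h = piv g.
  apply/eqP; rewrite eqEcard sub /=.
  have := G_rank h g nz_h; rewrite !rank_pivots; exact: id.
have s_u: u \in s by rewrite mem_s.
have lt_u: (index u s < size s)%N by rewrite index_mem.
have def_u: u = nth 0%MM s (Ordinal lt_u) by rewrite nth_index.
rewrite def_u; apply/pivP; rewrite eq_piv; apply/pivP; rewrite -def_u; exact: init_u.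
Qed.

Lemma gin_exists : exists J, is_gin (monomial_ideal (K := K) (fun b => N b)) J.
Proof.
have [F nzF F_init] := generic_initial_set.
have [_ [g0]] := generically_nzM Kinfinite nzF (generically_nz_det K n).
rewrite mulf_eq0 negb_or => /andP[nz_g0 det_g0].
have g0_unit : g0 \in unitmx by rewrite unitmxE unitfE.
exists (initial_ideal (lin_change_ideal g0 (monomial_ideal (fun b => N b)))).
exists (fun g => g \in unitmx /\ F g != 0); split.
- have [[f defF] _] := nzF; exists (eq f) => g; split=> [[g_unit nz_g]|[g_unit [_ <-]]].
    by split=> //; exists f; rewrite -?defF.
  by rewrite -defF.
- by exists g0.
move=> g [g_unit nz_g]; apply: initial_ideal_eq => u.
by split=> /F_init gen_u; apply/F_init => //; apply: gen_u.
Qed.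

End GenericInitialIdeal.

(** * The generic initial ideal of the sphere *)

Section GinOfStanleyReisner.
Variables (K : fieldType) (n : nat).
Hypothesis Kinfinite : forall s : seq K, exists x : K, x \notin s.
Variable C : {set 'I_n} -> Prop.
Hypothesis C_down : forall F H : {set 'I_n}, C H -> F \subset H -> C F.
Implicit Types (I J : {mpoly K[n]} -> Prop) (g : 'M[K]_n).

Lemma initial_ideal_ext g I J : (forall p, I p <-> J p) -> forall q,
  initial_ideal (lin_change_ideal g I) q <-> initial_ideal (lin_change_ideal g J) q.
Proof.
suff imp I1 I2 : (forall p, I1 p -> I2 p) -> forall q,
    initial_ideal (lin_change_ideal g I1) q -> initial_ideal (lin_change_ideal g I2) q.
  by move=> IJ q; split; apply: imp => p /IJ.
move=> I12 q [s s_gen def_q]; exists s => // c /s_gen[_ [u [[p Ip ->] init_u def_c]]].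
by exists (lin_change g p), u; split=> //; exists p => //; apply: I12.
Qed.

Lemma initial_stanley_reisner g u : g \in unitmx ->
  initial_ideal (lin_change_ideal g (stanley_reisner K C)) 'X_[u] <->
  initial_monomial g (nonface C) u.
Proof.
move=> g_unit; rewrite (initial_ideal_ext g (fun p => stanley_reisnerP p C_down)).
by apply: initial_ideal_monomial g_unit => v w; apply: nonface_up.
Qed.

Lemma stanley_reisner_gin_exists : exists J, is_gin (stanley_reisner K C) J.
Proof.
have decC (F : {set 'I_n}) : exists b : bool, b <-> ~ C F.
  by case: (classic (C F)) => [CF|nCF]; [exists false | exists true].
have [nC nCP] := fin_all_exists decC.
pose N : pred 'X_{1..n} := fun b => nC (vertices b).
have N_up u v : N u -> (u <= v)%MM -> N v.
  by move=> /nCP Nu le_uv; apply/nCP/(nonface_up C_down Nu le_uv).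
have [J [O [O_open O_ne O_J]]] := gin_exists Kinfinite N_up.
exists J, O; split=> // g Og q; rewrite -(O_J g Og q); apply: initial_ideal_ext => p.
rewrite (stanley_reisnerP p C_down).
by split=> Np b /Np /nCP.
Qed.

(** Two dense open conditions meet, so a generic initial ideal may be computed
    with one g that also satisfies all the nonvanishing conditions above. *)
Lemma gin_generic (J : {mpoly K[n]} -> Prop) : is_gin (stanley_reisner K C) J ->
  exists g, [/\ generic g, g \in unitmx &
    forall u, J 'X_[u] <-> initial_monomial g (nonface C) u].
Proof.
move=> [O [[S O_S] [g0 /O_S[_ [f Sf nz_f]]] O_J]].
have [F nzF F_generic] := generic_dense n Kinfinite.
have nz_pf : generically_nz (fun g : 'M[K]_n => f.@[mxvec g 0]).
  by split; [exists f | exists g0].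
have nz_pfF := generically_nzM Kinfinite nz_pf nzF.
have [_ [g]] := generically_nzM Kinfinite nz_pfF (generically_nz_det K n).
rewrite !mulf_eq0 !negb_or -andbA => /and3P[nz_fg nz_F nz_det].
have g_unit : g \in unitmx by rewrite unitmxE unitfE.
exists g; split=> // [|u]; first exact: F_generic.
have Og: O g by apply/O_S; split=> //; exists f.
rewrite -(initial_stanley_reisner u g_unit); exact: iff_sym (O_J g Og _).
Qed.

End GinOfStanleyReisner.

Lemma card_vertices n (b : 'X_{1..n}) : (#|vertices b| <= mdeg b)%N.
Proof.
rewrite -sum1_card mdegE [X in (_ <= X)%N](bigID (mem (vertices b))) /=.
apply: leq_trans (leq_addr _ _); apply: leq_sum => i; by rewrite inE.
Qed.

Local Close Scope ring_scope.

Theorem theorem4p2 (K : fieldType) (Kinfinite : forall s : seq K, exists x : K, x \notin s)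
    (n d : nat) (d_gt0 : 0 < d) (d_lt_n : d < n)
    (U : 'X_{1..n} -> Prop)
    (U_shifted : shifted_order_ideal (n - d - 1) U)
    (U_degree : degree_at_most (d %/ 2) U) :
  forall u : 'X_{1..n}, Uset K d (squeezed_sphere d U) u <-> U u.
Proof.
move=> u; split=> [[u_m not_gin]|Uu].
  apply: NNPP => nUu; apply: not_gin.
  have sphere_down : forall F H : {set 'I_n},
      squeezed_sphere d U H -> F \subset H -> squeezed_sphere d U F.
    by move=> F H; apply: generated_down.
  have [J ginJ] := stanley_reisner_gin_exists Kinfinite sphere_down.
  exists J => //; have [|g [g_generic g_unit J_init]] := gin_generic Kinfinite _ ginJ.
    exact: generated_down.
  apply/J_init; have [q Nq init_u] :=
    nonmember_initial d_lt_n U_shifted U_degree g_generic g_unit u_m nUu.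
  exists q => // b /Nq Nb Sb; exact/Nb/sphere_sub_ball.
split; first exact: (member_in_first U_shifted).
case=> J ginJ; have [|g [g_generic g_unit J_init]] := gin_generic Kinfinite _ ginJ.
  exact: generated_down.
move/J_init=> [q Nq init_u].
apply: (member_not_initial d_lt_n U_shifted U_degree g_generic g_unit Uu).
exists (truncate (mdeg u) q); last by rewrite lin_change_truncate.
move=> b /msupp_truncate[/Nq Nb deg_b] Bb; apply: Nb.
apply: (ball_sub_sphere d_lt_n U_shifted U_degree Bb).
apply: leq_trans (card_vertices b) _.
exact: leq_trans deg_b (U_degree _ Uu).
Qed.
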